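(* Let $u\in C^3(\mathbb R^2)$ satisfy $\inf_{\mathbb R^2}|\nabla u|>0$. Then there exists $\Phi\in C^1(\mathbb R^2;\mathbb R^2)$ whose Jacobian matrix $\nabla\Phi(x)$ is invertible for every $x\in\mathbb R^2$ and such that $\nabla\Phi\,\nabla u=e_1=(1,0)^T$ in $\mathbb R^2$. *)

(* Defs.v *)
From Stdlib Require Import Reals.
From Coquelicot Require Import Coquelicot.
Open Scope R_scope.

Definition pd1 (f : R -> R -> R) : R -> R -> R :=
  fun x y => Derive (fun t => f t y) x.
Definition pd2 (f : R -> R -> R) : R -> R -> R :=
  fun x y => Derive (fun t => f x t) y.

Definition cont2 (f : R -> R -> R) : Prop :=
  forall x y : R, continuous (fun p : R * R => f (fst p) (snd p)) (x, y).

Fixpoint Ck (k : nat) (f : R -> R -> R) : Prop :=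
  match k with
  | O => cont2 f
  | S k' =>
      cont2 f /\
      (forall x y : R, ex_derive (fun t => f t y) x /\ ex_derive (fun t => f x t) y) /\
      Ck k' (pd1 f) /\ Ck k' (pd2 f)
  end.

Definition grad_norm (u : R -> R -> R) (x y : R) : R :=
  sqrt (pd1 u x y ^ 2 + pd2 u x y ^ 2).

(* Main.v *)
Require Import Defs.
From Stdlib Require Import Reals.
From Stdlib Require Import Lra Lia FunctionalExtensionality IndefiniteDescription.
From Coquelicot Require Import Coquelicot.
Open Scope R_scope.

(** The field [b = grad u / |grad u|^2] is bounded and C^2, so its flow is
    complete and C^1 in the initial point, and [u] grows at unit speed along
    it. Hence every trajectory crosses the curve [u = 0] exactly once, and
    integrating [f / |grad u|^2] along trajectories from that curve yields a
    C^1 solution [w] of [grad w . grad u = f] for every C^1 function [f].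
    With [f = 1] this is the first component of Phi. With [f = - Laplacian u]
    the field [exp w * grad u] is divergence free, so rotating it by a right
    angle gives a gradient field, whose potential is the second component;
    the Jacobian determinant is then [exp w].

    The flow is differentiable in the initial point because its difference
    quotients are Cauchy, [|D_h - D_k| <= C (|h| + |k|)], by Gronwall's
    inequality; no variational equation has to be solved. *)

(** * Functions of class C^k *)

(** The rotated gradient of [u] is orthogonal to [grad u], but it is closed only where [u] is
    harmonic. The factor [exp w] repairs this, because [div (exp w * grad u) = exp w * (grad w .
    grad u + Laplacian u)]. The resulting condition on [w] is a transport equation of the same type
    as the one for the first component, so one solver serves both. The determinant is [exp w] times
    [grad P1 . grad u], which is why nothing about [P1] beyond its equation enters.

    The level curve [u = 0] is a convenient start because the crossing time is explicit and as
    smooth as [u]: no implicit function theorem is called for.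

    A Lipschitz constant of the field is available only on boxes. As the speed is at most [M], a
    trajectory that starts in the box of radius [B] stays up to time [T] in the box of radius
    [B + M * T], and all estimates are made there.

    Three derivatives of [u] serve twice: the Taylor remainder of the field has to be quadratic for
    the Cauchy rate of the quotients, and the Laplacian has to be C^1 to be a right-hand side. *)

Lemma cont2_comp {T : UniformSpace} (f : R -> R -> R) (a b : T -> R) (z : T) :
  cont2 f -> continuous a z -> continuous b z ->
  continuous (fun z => f (a z) (b z)) z.
Proof. intros Hf Ha Hb. apply continuous_comp_2; auto. Qed.

Lemma cont2_pt (f : R -> R -> R) : cont2 f -> forall x y, continuity_2d_pt f x y.
Proof. intros Hf x y. apply continuity_2d_pt_filterlim. apply Hf. Qed.

Lemma Ck_cont2 (k : nat) (f : R -> R -> R) : Ck k f -> cont2 f.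
Proof. destruct k; simpl; tauto. Qed.

Lemma Ck_pred (k : nat) (f : R -> R -> R) : Ck (S k) f -> Ck k f.
Proof.
  revert f; induction k as [|k IH]; intros f (Hc & Hd & H1 & H2).
  - exact Hc.
  - split; [exact Hc|]. split; [exact Hd|]. split; apply IH; assumption.
Qed.

Lemma pd1_is_derive (k : nat) (f : R -> R -> R) (x y : R) :
  Ck (S k) f -> is_derive (fun t => f t y) x (pd1 f x y).
Proof. intros (_ & Hd & _). apply Derive_correct. exact (proj1 (Hd x y)). Qed.

Lemma pd2_is_derive (k : nat) (f : R -> R -> R) (x y : R) :
  Ck (S k) f -> is_derive (fun t => f x t) y (pd2 f x y).
Proof. intros (_ & Hd & _). apply Derive_correct. exact (proj2 (Hd x y)). Qed.

(** [Ck] recurses on [Derive], so closure under an operation requires [pd1 f] and [pd2 f] to be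
    replaced by explicit formulas; functional extensionality turns the pointwise derivatives into
    the equalities that allow this. *)
Lemma Ck_S_intro (k : nat) (f f1 f2 : R -> R -> R) :
  cont2 f ->
  (forall x y, is_derive (fun t => f t y) x (f1 x y)) ->
  (forall x y, is_derive (fun t => f x t) y (f2 x y)) ->
  Ck k f1 -> Ck k f2 -> Ck (S k) f.
Proof.
  intros Hc D1 D2 H1 H2.
  assert (E1 : pd1 f = f1).
  { extensionality x; extensionality y. apply is_derive_unique, D1. }
  assert (E2 : pd2 f = f2).
  { extensionality x; extensionality y. apply is_derive_unique, D2. }
  simpl. rewrite E1, E2. repeat split; auto; eexists; eauto.
Qed.

Lemma Ck_const (k : nat) (c : R) : Ck k (fun _ _ => c).
Proof.
  revert c; induction k as [|k IH]; intros c.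
  - intros x y. apply continuous_const.
  - apply (Ck_S_intro k _ (fun _ _ => 0) (fun _ _ => 0)); auto.
    + intros x y. apply continuous_const.
    + intros x y. apply @is_derive_const.
    + intros x y. apply @is_derive_const.
Qed.

Lemma Ck_plus (k : nat) (f g : R -> R -> R) :
  Ck k f -> Ck k g -> Ck k (fun x y => f x y + g x y).
Proof.
  revert f g; induction k as [|k IH]; intros f g Hf Hg.
  - intros x y. apply @continuous_plus; [apply Hf | apply Hg].
  - apply (Ck_S_intro k _ (fun x y => pd1 f x y + pd1 g x y)
                          (fun x y => pd2 f x y + pd2 g x y)).
    + intros x y. apply @continuous_plus; eapply Ck_cont2; eauto.
    + intros x y. apply (is_derive_plus (fun t => f t y) (fun t => g t y));
        apply (pd1_is_derive k); assumption.
    + intros x y. apply (is_derive_plus (fun t => f x t) (fun t => g x t));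
        apply (pd2_is_derive k); assumption.
    + apply IH; [apply Hf | apply Hg].
    + apply IH; [apply Hf | apply Hg].
Qed.

Lemma Ck_mult (k : nat) (f g : R -> R -> R) :
  Ck k f -> Ck k g -> Ck k (fun x y => f x y * g x y).
Proof.
  revert f g; induction k as [|k IH]; intros f g Hf Hg.
  - intros x y. apply @continuous_mult; [apply Hf | apply Hg].
  - apply (Ck_S_intro k _ (fun x y => pd1 f x y * g x y + f x y * pd1 g x y)
                          (fun x y => pd2 f x y * g x y + f x y * pd2 g x y)).
    + intros x y. apply @continuous_mult; eapply Ck_cont2; eauto.
    + intros x y. apply (is_derive_mult (fun t => f t y) (fun t => g t y)).
      * apply (pd1_is_derive k); assumption.
      * apply (pd1_is_derive k); assumption.
      * intros; apply Rmult_comm.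
    + intros x y. apply (is_derive_mult (fun t => f x t) (fun t => g x t)).
      * apply (pd2_is_derive k); assumption.
      * apply (pd2_is_derive k); assumption.
      * intros; apply Rmult_comm.
    (* The factor that is not differentiated has class [S k]; [Ck_pred] lowers it to the class of
       the induction hypothesis. *)
    + apply Ck_plus; apply IH; try apply Hf; try apply Hg; apply Ck_pred; auto.
    + apply Ck_plus; apply IH; try apply Hf; try apply Hg; apply Ck_pred; auto.
Qed.

Lemma Ck_opp (k : nat) (f : R -> R -> R) : Ck k f -> Ck k (fun x y => - f x y).
Proof.
  intros Hf. replace (fun x y => - f x y) with (fun x y => -1 * f x y).
  - apply (Ck_mult k (fun _ _ => -1)); auto. apply Ck_const.
  - extensionality x; extensionality y. ring.
Qed.

Lemma Ck_inv (k : nat) (f : R -> R -> R) :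
  (forall x y, f x y <> 0) -> Ck k f -> Ck k (fun x y => / f x y).
Proof.
  intros Hn. induction k as [|k IH]; intros Hf.
  - intros x y. apply (continuous_comp (fun p : R * R => f (fst p) (snd p)) Rinv).
    + apply Hf.
    + apply continuous_Rinv, Hn.
  (* The square in the derivative is written as a product of two inverses, each covered by the
     induction hypothesis. *)
  - apply (Ck_S_intro k _ (fun x y => - pd1 f x y * (/ f x y * / f x y))
                          (fun x y => - pd2 f x y * (/ f x y * / f x y))).
    + intros x y. apply (continuous_comp (fun p : R * R => f (fst p) (snd p)) Rinv).
      * eapply Ck_cont2; eauto.
      * apply continuous_Rinv, Hn.
    + intros x y. replace (- pd1 f x y * (/ f x y * / f x y)) with (- pd1 f x y / f x y ^ 2)
        by (field; auto).
      apply (is_derive_inv (fun t => f t y)); auto. apply (pd1_is_derive k); assumption.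
    + intros x y. replace (- pd2 f x y * (/ f x y * / f x y)) with (- pd2 f x y / f x y ^ 2)
        by (field; auto).
      apply (is_derive_inv (fun t => f x t)); auto. apply (pd2_is_derive k); assumption.
    + apply Ck_mult; [apply Ck_opp, Hf | apply Ck_mult; apply IH, Ck_pred, Hf].
    + apply Ck_mult; [apply Ck_opp, Hf | apply Ck_mult; apply IH, Ck_pred, Hf].
Qed.

Lemma continuous_exp_comp {T : UniformSpace} (f : T -> R) (z : T) :
  continuous f z -> continuous (fun z => exp (f z)) z.
Proof. intros Hf. apply (continuous_comp f exp); auto. apply continuous_exp. Qed.

Lemma is_derive_exp_comp (f : R -> R) (x l : R) :
  is_derive f x l -> is_derive (fun t => exp (f t)) x (exp (f x) * l).
Proof.
  intros Hf. rewrite Rmult_comm. apply (is_derive_comp exp f); auto.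
  apply is_derive_exp.
Qed.

Lemma Ck_exp (k : nat) (f : R -> R -> R) : Ck k f -> Ck k (fun x y => exp (f x y)).
Proof.
  induction k as [|k IH]; intros Hf.
  - intros x y. apply continuous_exp_comp, Hf.
  - apply (Ck_S_intro k _ (fun x y => exp (f x y) * pd1 f x y)
                          (fun x y => exp (f x y) * pd2 f x y)).
    + intros x y. apply continuous_exp_comp. eapply Ck_cont2; eauto.
    + intros x y. apply (is_derive_exp_comp (fun t => f t y)). apply (pd1_is_derive k); assumption.
    + intros x y. apply (is_derive_exp_comp (fun t => f x t)). apply (pd2_is_derive k); assumption.
    + apply Ck_mult; [apply IH, Ck_pred, Hf | apply Hf].
    + apply Ck_mult; [apply IH, Ck_pred, Hf | apply Hf].
Qed.

(** Partial derivatives alone give no chain rule along a curve; the continuity of [pd1 f] supplies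
    the total differential that does. *)
Lemma C1_comp_curve (f : R -> R -> R) (a b : R -> R) (t da db : R) :
  Ck 1 f -> is_derive a t da -> is_derive b t db ->
  is_derive (fun s => f (a s) (b s)) t
    (pd1 f (a t) (b t) * da + pd2 f (a t) (b t) * db).
Proof.
  intros Hf Ha Hb. apply is_derive_Reals. apply derivable_pt_lim_comp_2d.
  - apply filterdiff_differentiable_pt_lim.
    eapply filterdiff_ext_lin;
      [apply (is_derive_filterdiff f (a t) (b t) (pd1 f) (pd2 f (a t) (b t)))|].
    + apply filter_forall. intros u. exact (pd1_is_derive 0 f (fst u) (snd u) Hf).
    + exact (pd2_is_derive 0 f (a t) (b t) Hf).
    + exact (proj1 (proj2 (proj2 Hf)) (a t) (b t)).
    + intros u. reflexivity.
  - apply is_derive_Reals, Ha.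
  - apply is_derive_Reals, Hb.
Qed.

(** * Mean value and Taylor estimates on squares *)

Lemma MVT_abs_bound (f df : R -> R) (a b K : R) :
  (forall x, Rmin a b <= x <= Rmax a b -> is_derive f x (df x)) ->
  (forall x, Rmin a b <= x <= Rmax a b -> Rabs (df x) <= K) ->
  Rabs (f b - f a) <= K * Rabs (b - a).
Proof.
  intros Hd HK. destruct (MVT_gen f a b df) as (c & Hc & E).
  - intros x Hx. apply Hd; lra.
  - intros x Hx. apply continuity_pt_filterlim, (ex_derive_continuous f).
    eexists; apply Hd, Hx.
  - rewrite E, Rabs_mult. apply Rmult_le_compat_r; [apply Rabs_pos | auto].
Qed.

Lemma between_abs_le (a b B x : R) :
  Rabs a <= B -> Rabs b <= B -> Rmin a b <= x <= Rmax a b -> Rabs x <= B.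
Proof.
  intros Ha%Rabs_le_between Hb%Rabs_le_between Hx. apply Rabs_le_between.
  revert Hx; unfold Rmin, Rmax; destruct (Rle_dec a b); lra.
Qed.

(** Walk from the origin to the point in [n] equal steps along the ray. Each step is shorter than
    the modulus of uniform continuity for the tolerance 1, so [f] changes by less than 1 per step,
    and [n] is the same for all points of the square. *)
Lemma cont2_bounded (f : R -> R -> R) (B : R) :
  cont2 f -> exists K, 0 < K /\
    forall x y, Rabs x <= B -> Rabs y <= B -> Rabs (f x y) <= K.
Proof.
  intros Hf.
  destruct (uniform_continuity_2d f (-B) B (-B) B
              (fun x y _ _ => cont2_pt f Hf x y) (mkposreal 1 Rlt_0_1)) as [d Hd].
  simpl in Hd.
  (* For negative [B] the square is empty and any constant will do. *)
  destruct (Rle_dec 0 B) as [HB|HB];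
    [|exists 1; split; [lra|]; intros x y Hx; pose proof (Rabs_pos x); lra].
  destruct (nfloor_ex (B / d)) as [m [_ Hm]].
  { apply Rle_div_r; [apply cond_pos | lra]. }
  (* [m] is the integer part of [B / d], so [B / (m + 1) < d]. *)
  set (n := (S m)%nat).
  assert (Hn : 0 < INR n) by (apply lt_0_INR; unfold n; lia).
  assert (Hs : B / INR n < d).
  { apply Rlt_div_l; auto. apply Rlt_div_l in Hm; [|apply cond_pos].
    unfold n; rewrite S_INR; lra. }
  exists (Rabs (f 0 0) + INR n); split; [pose proof (Rabs_pos (f 0 0)); lra|].
  intros x y Hx Hy.
  assert (Hz : forall z j, (j <= n)%nat -> Rabs z <= B -> -B <= INR j * (z / INR n) <= B).
  { intros z j Hj Hz. apply Rabs_le_between.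
    replace (INR j * (z / INR n)) with (INR j / INR n * z) by (field; lra).
    rewrite Rabs_mult. apply le_INR in Hj. pose proof (pos_INR j).
    rewrite Rabs_pos_eq by (apply Rdiv_le_0_compat; lra).
    assert (INR j / INR n <= 1) by (apply Rle_div_l; lra).
    pose proof (Rabs_pos z).
    assert (0 <= INR j / INR n) by (apply Rdiv_le_0_compat; lra). nra. }
  assert (Hst : forall z j, Rabs z <= B ->
            Rabs (INR (S j) * (z / INR n) - INR j * (z / INR n)) < d).
  { intros z j Hz'. rewrite S_INR.
    replace ((INR j + 1) * (z / INR n) - INR j * (z / INR n)) with (z / INR n) by ring.
    unfold Rdiv. rewrite Rabs_mult, (Rabs_pos_eq (/ INR n)).
    - eapply Rle_lt_trans; [|apply Hs]. apply Rmult_le_compat_r; auto.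
      left; apply Rinv_0_lt_compat; auto.
    - left; apply Rinv_0_lt_compat; auto. }
  assert (H : forall j, (j <= n)%nat ->
            Rabs (f (INR j * (x / INR n)) (INR j * (y / INR n))) <= Rabs (f 0 0) + INR j).
  { induction j as [|j IH]; intros Hj.
    - simpl. rewrite !Rmult_0_l. lra.
    - assert (Hj' : (j <= n)%nat) by lia.
      specialize (IH Hj').
      pose proof (Hd _ _ _ _ (Hz x j Hj' Hx) (Hz y j Hj' Hy) (Hz x _ Hj Hx) (Hz y _ Hj Hy)
                    (Hst x j Hx) (Hst y j Hy)) as H.
      rewrite S_INR in *.
      apply Rabs_lt_between in H. apply Rabs_le_between in IH. apply Rabs_le_between.
      lra. }
  specialize (H n (le_n _)).
  replace (INR n * (x / INR n)) with x in H by (field; lra).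
  replace (INR n * (y / INR n)) with y in H by (field; lra). exact H.
Qed.

Definition lip_box (f : R -> R -> R) (B K : R) : Prop :=
  forall x y x' y', Rabs x <= B -> Rabs y <= B -> Rabs x' <= B -> Rabs y' <= B ->
    Rabs (f x' y' - f x y) <= K * (Rabs (x' - x) + Rabs (y' - y)).

Lemma lip_box_weaken (f : R -> R -> R) (B K K' : R) :
  K <= K' -> lip_box f B K -> lip_box f B K'.
Proof.
  intros HK H x y x' y' Hx Hy Hx' Hy'. eapply Rle_trans; [apply H; auto|].
  apply Rmult_le_compat_r; auto.
  pose proof (Rabs_pos (x' - x)); pose proof (Rabs_pos (y' - y)); lra.
Qed.

(** Move one coordinate at a time through the corner [(x, y')], which stays in the square. *)
Lemma C1_lip_box (f : R -> R -> R) (B : R) :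
  Ck 1 f -> exists K, 0 < K /\ lip_box f B K.
Proof.
  intros Hf.
  destruct (cont2_bounded (pd1 f) B) as (K1 & HK1 & B1); [apply Hf|].
  destruct (cont2_bounded (pd2 f) B) as (K2 & HK2 & B2); [apply Hf|].
  exists (K1 + K2); split; [lra|]. intros x y x' y' Hx Hy Hx' Hy'.
  assert (H1 : Rabs (f x' y' - f x y') <= K1 * Rabs (x' - x)).
  { apply (MVT_abs_bound (fun t => f t y') (fun t => pd1 f t y')).
    - intros t Ht. apply (pd1_is_derive 0); assumption.
    - intros t Ht. apply B1; auto. apply (between_abs_le x x'); auto. }
  assert (H2 : Rabs (f x y' - f x y) <= K2 * Rabs (y' - y)).
  { apply (MVT_abs_bound (fun t => f x t) (fun t => pd2 f x t)).
    - intros t Ht. apply (pd2_is_derive 0); assumption.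
    - intros t Ht. apply B2; auto. apply (between_abs_le y y'); auto. }
  pose proof (Rabs_pos (x' - x)); pose proof (Rabs_pos (y' - y)).
  replace (f x' y' - f x y) with ((f x' y' - f x y') + (f x y' - f x y)) by ring.
  eapply Rle_trans; [apply Rabs_triang|]. nra.
Qed.

(** On each leg through the corner, the linear part with slope frozen at [(x, y)] is subtracted. The
    derivative of what remains is the variation of a partial derivative, of first order in the
    displacement; the length of the leg gives the second order. *)
Lemma C2_taylor_box (f : R -> R -> R) (B : R) :
  Ck 2 f -> exists K, 0 < K /\
    forall x y x' y', Rabs x <= B -> Rabs y <= B -> Rabs x' <= B -> Rabs y' <= B ->
    Rabs (f x' y' - f x y - (pd1 f x y * (x' - x) + pd2 f x y * (y' - y)))
      <= K * (Rabs (x' - x) + Rabs (y' - y)) ^ 2.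
Proof.
  intros Hf.
  destruct (C1_lip_box (pd1 f) B) as (K1 & HK1 & L1); [apply Hf|].
  destruct (C1_lip_box (pd2 f) B) as (K2 & HK2 & L2); [apply Hf|].
  exists (K1 + K2); split; [lra|]. intros x y x' y' Hx Hy Hx' Hy'.
  set (S := Rabs (x' - x) + Rabs (y' - y)).
  pose proof (Rabs_pos (x' - x)); pose proof (Rabs_pos (y' - y)).
  assert (Hd : forall a b t, Rmin a b <= t <= Rmax a b -> Rabs (t - a) <= Rabs (b - a)).
  { intros a b t Ht. revert Ht. unfold Rmin, Rmax, Rabs.
    repeat destruct Rcase_abs; destruct Rle_dec; lra. }
  assert (H1 : Rabs ((f x' y' - pd1 f x y * x') - (f x y' - pd1 f x y * x))
               <= K1 * S * Rabs (x' - x)).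
  { apply (MVT_abs_bound (fun t => f t y' - pd1 f x y * t) (fun t => pd1 f t y' - pd1 f x y)).
    - intros t Ht. apply @is_derive_minus; [apply (pd1_is_derive 1); assumption|].
      evar_last; [apply is_derive_scal, @is_derive_id|]. unfold one; simpl; ring.
    - intros t Ht. eapply Rle_trans; [apply L1; auto; apply (between_abs_le x x'); auto|].
      apply Rmult_le_compat_l; [lra|]. specialize (Hd _ _ _ Ht). unfold S; lra. }
  assert (H2 : Rabs ((f x y' - pd2 f x y * y') - (f x y - pd2 f x y * y))
               <= K2 * S * Rabs (y' - y)).
  { apply (MVT_abs_bound (fun t => f x t - pd2 f x y * t) (fun t => pd2 f x t - pd2 f x y)).
    - intros t Ht. apply @is_derive_minus; [apply (pd2_is_derive 1); assumption|].
      evar_last; [apply is_derive_scal, @is_derive_id|]. unfold one; simpl; ring.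
    - intros t Ht. eapply Rle_trans; [apply L2; auto; apply (between_abs_le y y'); auto|].
      apply Rmult_le_compat_l; [lra|]. specialize (Hd _ _ _ Ht).
      replace (x - x) with 0 by ring. rewrite Rabs_R0. unfold S; lra. }
  replace (f x' y' - f x y - (pd1 f x y * (x' - x) + pd2 f x y * (y' - y)))
    with (((f x' y' - pd1 f x y * x') - (f x y' - pd1 f x y * x)) +
          ((f x y' - pd2 f x y * y') - (f x y - pd2 f x y * y))) by ring.
  eapply Rle_trans; [apply Rabs_triang|].
  assert (0 <= K1 * S) by (unfold S; nra). assert (0 <= K2 * S) by (unfold S; nra).
  apply Rle_trans with (K1 * S * Rabs (x' - x) + K2 * S * Rabs (y' - y)); [lra|].
  replace ((K1 + K2) * S ^ 2) with (K1 * S * S + K2 * S * S) by ring.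
  apply Rplus_le_compat; apply Rmult_le_compat_l; auto; unfold S; lra.
Qed.

(** * Gronwall inequalities *)

Lemma derivative_comparison (f df g dg : R -> R) (t : R) :
  0 <= t ->
  (forall s, 0 <= s <= t -> is_derive f s (df s)) ->
  (forall s, 0 <= s <= t -> is_derive g s (dg s)) ->
  (forall s, 0 <= s <= t -> df s <= dg s) ->
  f t - f 0 <= g t - g 0.
Proof.
  intros Ht Hf Hg Hle.
  assert (Hd : forall s, Rmin 0 t <= s <= Rmax 0 t ->
                 is_derive (fun s => g s - f s) s (dg s - df s)).
  { intros s Hs. rewrite Rmin_left, Rmax_right in Hs by lra.
    apply @is_derive_minus; auto. }
  destruct (MVT_gen (fun s => g s - f s) 0 t (fun s => dg s - df s)) as (c & Hc & E).
  - intros s Hs. apply Hd; lra.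
  - intros s Hs. apply continuity_pt_filterlim.
    apply (ex_derive_continuous (fun s => g s - f s)). eexists; apply Hd, Hs.
  - rewrite Rmin_left, Rmax_right in Hc by lra.
    assert (0 <= (dg c - df c) * (t - 0))
      by (apply Rmult_le_pos; [specialize (Hle c Hc)|]; lra). lra.
Qed.

Lemma is_derive_reflect (f : R -> R) (t l : R) :
  is_derive f (- t) l -> is_derive (fun s => f (- s)) t (- l).
Proof.
  intros H. replace (- l) with (-1 * l) by ring.
  apply (is_derive_comp f (fun s => - s)); auto.
  apply (is_derive_opp (fun s : R => s) t 1). apply @is_derive_id.
Qed.

Lemma is_derive_exp_lin (k s : R) :
  is_derive (fun s => exp (k * s)) s (k * exp (k * s)).
Proof.
  rewrite Rmult_comm. apply (is_derive_exp_comp (fun s => k * s)).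
  evar_last; [apply is_derive_scal, @is_derive_id|]. unfold one; simpl; ring.
Qed.

Lemma exp_mono (x y : R) : x <= y -> exp x <= exp y.
Proof.
  intros [H|H]; [left; apply exp_increasing, H | rewrite H; lra].
Qed.

(** The contraction mechanism of an exponentially weighted sup norm: integration gains the factor
    [1 / k], whatever the length [T]. This lets Picard iteration converge on all of [[-T, T]] at
    once. *)
Lemma abs_bound_by_exp (f df : R -> R) (c k T : R) :
  0 < k -> 0 <= c -> f 0 = 0 ->
  (forall s, Rabs s <= T -> is_derive f s (df s)) ->
  (forall s, Rabs s <= T -> Rabs (df s) <= c * exp (k * Rabs s)) ->
  forall t, Rabs t <= T -> Rabs (f t) <= c / k * exp (k * Rabs t).
Proof.
  intros Hk Hc. revert f df.
  assert (Pos : forall f df, f 0 = 0 ->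
    (forall s, Rabs s <= T -> is_derive f s (df s)) ->
    (forall s, Rabs s <= T -> Rabs (df s) <= c * exp (k * Rabs s)) ->
    forall t, 0 <= t -> Rabs t <= T -> f t <= c / k * exp (k * t)).
  { intros f df H0 Hd Hb t Ht HtT.
    assert (Hs : forall s, 0 <= s <= t -> Rabs s <= T).
    { intros s Hs. rewrite Rabs_pos_eq in * by lra. lra. }
    assert (H := derivative_comparison f df (fun s => c / k * exp (k * s))
                   (fun s => c / k * (k * exp (k * s))) t Ht).
    rewrite H0, Rmult_0_r, exp_0 in H.
    assert (0 <= c / k) by (apply Rdiv_le_0_compat; lra).
    enough (f t - 0 <= c / k * exp (k * t) - c / k * 1) by lra.
    apply H; auto.
    - intros s _. apply is_derive_scal, is_derive_exp_lin.
    - intros s Hs'. specialize (Hb s (Hs s Hs')). rewrite (Rabs_pos_eq s) in Hb by lra.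
      replace (c / k * (k * exp (k * s))) with (c * exp (k * s)) by (field; lra).
      apply Rabs_le_between in Hb; lra. }
  (* [- f] satisfies the same hypotheses, which gives the lower bound; negative times then follow by
     reflection. *)
  assert (Abs : forall f df, f 0 = 0 ->
    (forall s, Rabs s <= T -> is_derive f s (df s)) ->
    (forall s, Rabs s <= T -> Rabs (df s) <= c * exp (k * Rabs s)) ->
    forall t, 0 <= t -> Rabs t <= T -> Rabs (f t) <= c / k * exp (k * t)).
  { intros f df H0 Hd Hb t Ht HtT. apply Rabs_le_between; split.
    - enough (- f t <= c / k * exp (k * t)) by lra.
      apply (Pos (fun s => - f s) (fun s => - df s)); auto.
      + rewrite H0; ring.
      + intros s Hs. apply @is_derive_opp; auto.
      + intros s Hs. rewrite Rabs_Ropp; auto.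
    - eapply Pos; eauto. }
  intros f df H0 Hd Hb t Ht.
  destruct (Rle_dec 0 t) as [Hp|Hn].
  - rewrite (Rabs_pos_eq t) by lra. eapply Abs; eauto.
  - rewrite (Rabs_left t) by lra. rewrite <- (Ropp_involutive t) at 1.
    apply (Abs (fun s => f (- s)) (fun s => - df (- s))); try lra.
    + rewrite Ropp_0; auto.
    + intros s Hs. apply is_derive_reflect, Hd. rewrite Rabs_Ropp; auto.
    + intros s Hs. rewrite Rabs_Ropp, <- (Rabs_Ropp s). apply Hb. rewrite Rabs_Ropp; auto.
    + rewrite Rabs_Ropp; auto.
Qed.

(** The derivative is bounded in absolute value, not only from above, so that the hypothesis
    survives the time reversal that reduces negative [t] to positive [t]. *)
Lemma gronwall (f df : R -> R) (k d T : R) :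
  0 <= k -> 0 <= d ->
  (forall s, Rabs s <= T -> is_derive f s (df s)) ->
  (forall s, Rabs s <= T -> Rabs (df s) <= k * f s + d) ->
  forall t, Rabs t <= T -> f t <= (f 0 + d * Rabs t) * exp (k * Rabs t).
Proof.
  intros Hk Hd0. revert f df.
  assert (Pos : forall f df,
    (forall s, Rabs s <= T -> is_derive f s (df s)) ->
    (forall s, Rabs s <= T -> Rabs (df s) <= k * f s + d) ->
    forall t, 0 <= t -> Rabs t <= T -> f t <= (f 0 + d * t) * exp (k * t)).
  { intros f df Hd Hb t Ht HtT.
    assert (Hs : forall s, 0 <= s <= t -> Rabs s <= T).
    { intros s Hs. rewrite Rabs_pos_eq in * by lra. lra. }
    (* With the integrating factor the derivative is [(df s - k * f s) * exp (- k * s)], at most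
       [d * exp (- k * s)] and hence at most [d]. *)
    assert (H : f t * exp (- k * t) - f 0 * exp (- k * 0) <= d * t - d * 0).
    { apply (derivative_comparison (fun s => f s * exp (- k * s))
               (fun s => df s * exp (- k * s) + f s * (- k * exp (- k * s)))
               (fun s => d * s) (fun s => d)); auto.
      - intros s Hs'. apply (is_derive_mult f (fun s => exp (- k * s))); auto.
        + apply is_derive_exp_lin.
        + intros; apply Rmult_comm.
      - intros s _. evar_last; [apply is_derive_scal, @is_derive_id|].
        unfold one; simpl; ring.
      - intros s Hs'. specialize (Hb s (Hs s Hs')). apply Rabs_le_between in Hb.
        assert (exp (- k * s) <= 1).
        { rewrite <- exp_0. apply exp_mono. nra. }
        pose proof (exp_pos (- k * s)). nra. }
    rewrite !Rmult_0_r, exp_0 in H.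
    assert (E : exp (- k * t) * exp (k * t) = 1).
    { rewrite <- exp_plus, <- exp_0. f_equal; ring. }
    replace (f t) with (f t * exp (- k * t) * exp (k * t))
      by (rewrite Rmult_assoc, E; ring).
    apply Rmult_le_compat_r; [left; apply exp_pos | lra]. }
  intros f df Hd Hb t Ht.
  destruct (Rle_dec 0 t) as [Hp|Hn].
  - rewrite (Rabs_pos_eq t) by lra. eapply Pos; eauto.
  - rewrite (Rabs_left t) by lra. rewrite <- (Ropp_involutive t) at 1.
    rewrite <- Ropp_0 at 1.
    apply (Pos (fun s => f (- s)) (fun s => - df (- s))); try lra.
    + intros s Hs. apply is_derive_reflect, Hd. rewrite Rabs_Ropp; auto.
    + intros s Hs. rewrite Rabs_Ropp. apply Hb. rewrite Rabs_Ropp; auto.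
    + rewrite Rabs_Ropp; auto.
Qed.

(** Absolute values are not differentiable, so Gronwall is applied to [r1^2 + r2^2]. The constant
    [C] is fixed before the functions because it has to be uniform over all pairs of trajectories,
    and over all steps of the difference quotients. *)
Lemma gronwall_pair (K T : R) :
  0 <= K -> 0 <= T -> exists C, 0 < C /\
  forall (r1 r2 d1 d2 : R -> R) (d : R), 0 <= d ->
  (forall s, Rabs s <= T -> is_derive r1 s (d1 s)) ->
  (forall s, Rabs s <= T -> is_derive r2 s (d2 s)) ->
  (forall s, Rabs s <= T -> Rabs (d1 s) <= K * (Rabs (r1 s) + Rabs (r2 s)) + d) ->
  (forall s, Rabs s <= T -> Rabs (d2 s) <= K * (Rabs (r1 s) + Rabs (r2 s)) + d) ->
  forall t, Rabs t <= T ->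
  Rabs (r1 t) + Rabs (r2 t) <= C * (Rabs (r1 0) + Rabs (r2 0) + d).
Proof.
  intros HK HT. set (G := (1 + T) * exp ((4 * K + 2) * T)).
  assert (HG : 1 <= G).
  { unfold G. assert (1 <= exp ((4 * K + 2) * T)).
    { rewrite <- exp_0. apply exp_mono. nra. } nra. }
  exists (2 * G); split; [lra|].
  intros r1 r2 d1 d2 d Hd H1 H2 B1 B2 t Ht.
  set (f := fun s => r1 s * r1 s + r2 s * r2 s).
  set (S0 := Rabs (r1 0) + Rabs (r2 0) + d).
  assert (HS0 : 0 <= S0).
  { unfold S0. pose proof (Rabs_pos (r1 0)); pose proof (Rabs_pos (r2 0)); lra. }
  assert (Sq : forall z, z * z = Rabs z * Rabs z).
  { intros z. rewrite <- Rabs_mult, Rabs_pos_eq; auto. nra. }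
  assert (H : f t <= (f 0 + d * d * Rabs t) * exp ((4 * K + 2) * Rabs t)).
  { apply (gronwall f (fun s => (d1 s * r1 s + r1 s * d1 s) + (d2 s * r2 s + r2 s * d2 s))
             (4 * K + 2) (d * d) T); auto; try nra.
    - intros s Hs. apply @is_derive_plus.
      + apply (is_derive_mult r1 r1); auto. intros; apply Rmult_comm.
      + apply (is_derive_mult r2 r2); auto. intros; apply Rmult_comm.
    - intros s Hs. specialize (B1 s Hs). specialize (B2 s Hs). unfold f.
      rewrite (Sq (r1 s)), (Sq (r2 s)).
      replace (d1 s * r1 s + r1 s * d1 s + (d2 s * r2 s + r2 s * d2 s))
        with (2 * (d1 s * r1 s + d2 s * r2 s)) by ring.
      pose proof (Rabs_pos (r1 s)); pose proof (Rabs_pos (r2 s)).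
      set (a := Rabs (r1 s)) in *. set (b := Rabs (r2 s)) in *.
      assert (Rabs (d1 s * r1 s + d2 s * r2 s) <= (K * (a + b) + d) * (a + b)).
      { eapply Rle_trans; [apply Rabs_triang|]. rewrite !Rabs_mult.
        fold a b. nra. }
      rewrite Rabs_mult, Rabs_pos_eq by lra.
      (* These squares give [2 * K * (a + b)^2 <= 4 * K * (a^2 + b^2)] and
         [2 * d * (a + b) <= d^2 + 2 * (a^2 + b^2)], whence the rate [4 * K + 2] and the forcing
         [d * d]. *)
      assert (0 <= K * (a - b) ^ 2) by (apply Rmult_le_pos; auto; apply pow2_ge_0).
      pose proof (pow2_ge_0 (a + b - d)). pose proof (pow2_ge_0 (a - b)). nra. }
  (* Since [1 <= G], the bound [G * S0^2] is at most a perfect square, and no root of the constant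
     appears. *)
  assert (Hf : f t <= (G * S0) * (G * S0)).
  { pose proof (Rabs_pos t). pose proof (exp_pos ((4 * K + 2) * Rabs t)).
    assert (f 0 + d * d * Rabs t <= (1 + T) * (S0 * S0)).
    { unfold f. rewrite (Sq (r1 0)), (Sq (r2 0)).
      pose proof (Rabs_pos (r1 0)); pose proof (Rabs_pos (r2 0)).
      assert (d * d <= S0 * S0) by (unfold S0; nra).
      assert (Rabs (r1 0) * Rabs (r1 0) + Rabs (r2 0) * Rabs (r2 0) <= S0 * S0)
        by (unfold S0; nra).
      assert (d * d * Rabs t <= S0 * S0 * T) by (apply Rmult_le_compat; nra). nra. }
    assert (exp ((4 * K + 2) * Rabs t) <= exp ((4 * K + 2) * T))
      by (apply exp_mono; nra).
    apply Rle_trans with ((1 + T) * (S0 * S0) * exp ((4 * K + 2) * T)).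
    - eapply Rle_trans; [apply H|].
      assert (0 <= f 0) by (unfold f; nra).
      assert (0 <= d * d * Rabs t) by (apply Rmult_le_pos; nra).
      apply Rmult_le_compat; lra.
    - replace ((1 + T) * (S0 * S0) * exp ((4 * K + 2) * T)) with (G * (S0 * S0))
        by (unfold G; ring).
      assert (0 <= S0 * S0) by nra. nra. }
  assert (Hr : forall z, z * z <= f t -> Rabs z <= G * S0).
  { intros z Hz. apply Rsqr_incr_0; unfold Rsqr.
    - rewrite <- Sq. lra.
    - apply Rabs_pos.
    - apply Rmult_le_pos; lra. }
  assert (Rabs (r1 t) <= G * S0) by (apply Hr; unfold f; nra).
  assert (Rabs (r2 t) <= G * S0) by (apply Hr; unfold f; nra).
  fold S0. lra.
Qed.

(** Telescoping against a geometric series, whose sum is the factor 2. The rate is kept with the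
    limit: it gives the uniform convergence of the Picard iterates and the error of the difference
    quotients. *)
Lemma geometric_limit (u : nat -> R) (C : R) :
  (forall n, Rabs (u (S n) - u n) <= C * (1 / 2) ^ n) ->
  is_lim_seq u (real (Lim_seq u)) /\
  forall n, Rabs (real (Lim_seq u) - u n) <= 2 * C * (1 / 2) ^ n.
Proof.
  intros H.
  assert (HC : 0 <= C).
  { specialize (H 0%nat). simpl in H. pose proof (Rabs_pos (u 1%nat - u 0%nat)). lra. }
  assert (Hp : forall n, 0 < (1 / 2) ^ n) by (intros; apply pow_lt; lra).
  (* The subtracted term lets the induction on [m] close; it is dropped right afterwards. *)
  assert (B' : forall n m, Rabs (u (n + m)%nat - u n)
                 <= 2 * C * ((1 / 2) ^ n - (1 / 2) ^ (n + m))).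
  { intros n m. induction m as [|m IH].
    - rewrite Nat.add_0_r. rewrite !Rminus_diag, Rabs_R0. lra.
    - rewrite <- plus_n_Sm. specialize (H (n + m)%nat). simpl pow.
      replace (u (S (n + m)) - u n)
        with ((u (S (n + m)) - u (n + m)%nat) + (u (n + m)%nat - u n)) by ring.
      eapply Rle_trans; [apply Rabs_triang|]. lra. }
  assert (B : forall n m, Rabs (u (n + m)%nat - u n) <= 2 * C * (1 / 2) ^ n).
  { intros n m. specialize (B' n m). specialize (Hp (n + m)%nat). nra. }
  assert (Hc : ex_finite_lim_seq u).
  { apply ex_lim_seq_cauchy_corr. intros eps.
    destruct (pow_lt_1_zero (1 / 2) ltac:(rewrite Rabs_pos_eq; lra)
                (eps / (4 * C + 1))) as [N HN].
    { apply Rdiv_lt_0_compat; [apply cond_pos | lra]. }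
    exists N. intros n m Hn Hm.
    specialize (HN N (le_n _)). rewrite Rabs_pos_eq in HN by (left; apply Hp).
    apply Rlt_div_r in HN; [|lra].
    pose proof (B N (n - N)%nat) as H1. pose proof (B N (m - N)%nat) as H2.
    replace (N + (n - N))%nat with n in H1 by lia.
    replace (N + (m - N))%nat with m in H2 by lia.
    replace (u n - u m) with ((u n - u N) - (u m - u N)) by ring.
    eapply Rle_lt_trans; [apply Rabs_triang|]. rewrite Rabs_Ropp.
    specialize (Hp N). lra. }
  apply Lim_seq_correct' in Hc. split; auto.
  intros n.
  assert (L : is_lim_seq (fun m => Rabs (u (m + n)%nat - u n))
                (Rabs (real (Lim_seq u) - u n))).
  { apply (is_lim_seq_abs _ (Finite (real (Lim_seq u) - u n))).
    apply is_lim_seq_minus'; [apply is_lim_seq_incr_n, Hc | apply is_lim_seq_const]. }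
  refine (is_lim_seq_le _ _ _ _ _ L (is_lim_seq_const _)).
  intros m. simpl. rewrite Nat.add_comm. apply B.
Qed.

(** * Existence of the flow *)

Definition solves (p q : R -> R -> R) (a b : R -> R) : Prop :=
  forall t, is_derive a t (p (a t) (b t)) /\ is_derive b t (q (a t) (b t)).

Definition bounded_by (M : R) (p : R -> R -> R) : Prop :=
  forall x y, Rabs (p x y) <= M.

Lemma bounded_by_nonneg (M : R) (p : R -> R -> R) : bounded_by M p -> 0 <= M.
Proof. intros Bp. pose proof (Bp 0 0); pose proof (Rabs_pos (p 0 0)); lra. Qed.

Lemma is_derive_continuous (f : R -> R) (t l : R) : is_derive f t l -> continuous f t.
Proof. intros H. apply (ex_derive_continuous f). exists l. exact H. Qed.

Lemma is_derive_primitive (f : R -> R) (c t : R) :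
  (forall s, continuous f s) -> is_derive (fun t => c + RInt f 0 t) t (f t).
Proof.
  intros Hf. replace (f t) with (0 + f t) by ring.
  apply (is_derive_plus (fun _ => c) (fun t => RInt f 0 t)).
  - apply @is_derive_const.
  - apply (is_derive_RInt f (fun t => RInt f 0 t) 0); auto.
    apply filter_forall. intros s. apply @RInt_correct, @ex_RInt_continuous. auto.
Qed.

Fixpoint picard (p q : R -> R -> R) (x y : R) (n : nat) : (R -> R) * (R -> R) :=
  match n with
  | O => (fun _ => x, fun _ => y)
  | S m =>
      let z := picard p q x y m in
      (fun t => x + RInt (fun s => p (fst z s) (snd z s)) 0 t,
       fun t => y + RInt (fun s => q (fst z s) (snd z s)) 0 t)
  end.

Lemma picard_initial (p q : R -> R -> R) (x y : R) (n : nat) :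
  fst (picard p q x y n) 0 = x /\ snd (picard p q x y n) 0 = y.
Proof.
  destruct n; simpl; auto. rewrite !RInt_point. unfold zero; simpl. split; ring.
Qed.

Lemma picard_continuous (p q : R -> R -> R) (x y : R) (n : nat) (t : R) :
  cont2 p -> cont2 q ->
  continuous (fst (picard p q x y n)) t /\ continuous (snd (picard p q x y n)) t.
Proof.
  intros Hp Hq. revert t; induction n as [|n IH]; intros t; simpl.
  - split; apply continuous_const.
  - split; eapply is_derive_continuous, is_derive_primitive;
      intros s; destruct (IH s); apply cont2_comp; assumption.
Qed.

Lemma picard_derive (p q : R -> R -> R) (x y : R) (n : nat) (t : R) :
  cont2 p -> cont2 q ->
  let z := picard p q x y n in
  is_derive (fst (picard p q x y (S n))) t (p (fst z t) (snd z t)) /\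
  is_derive (snd (picard p q x y (S n))) t (q (fst z t) (snd z t)).
Proof.
  intros Hp Hq z. simpl. fold z.
  split.
  - apply (is_derive_primitive (fun s => p (fst z s) (snd z s))).
    intros s. destruct (picard_continuous p q x y n s Hp Hq).
    apply cont2_comp; assumption.
  - apply (is_derive_primitive (fun s => q (fst z s) (snd z s))).
    intros s. destruct (picard_continuous p q x y n s Hp Hq).
    apply cont2_comp; assumption.
Qed.

(** An iterate is constant or has a value of the field as its derivative. The bound is uniform in
    [n], which keeps all iterates up to time [T] in one box, where a Lipschitz constant is at
    hand. *)
Lemma picard_lipschitz (p q : R -> R -> R) (M x y : R) (n : nat) (s t : R) :
  cont2 p -> cont2 q -> bounded_by M p -> bounded_by M q ->
  Rabs (fst (picard p q x y n) t - fst (picard p q x y n) s) <= M * Rabs (t - s) /\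
  Rabs (snd (picard p q x y n) t - snd (picard p q x y n) s) <= M * Rabs (t - s).
Proof.
  intros Hp Hq Bp Bq.
  pose proof (bounded_by_nonneg M p Bp) as HM.
  destruct n as [|n].
  - simpl. rewrite !Rminus_diag, Rabs_R0. pose proof (Rabs_pos (t - s)). split; nra.
  - set (z := picard p q x y n).
    split.
    + apply (MVT_abs_bound _ (fun t => p (fst z t) (snd z t))); intros r _.
      * apply picard_derive; auto.
      * apply Bp.
    + apply (MVT_abs_bound _ (fun t => q (fst z t) (snd z t))); intros r _.
      * apply picard_derive; auto.
      * apply Bq.
Qed.

Lemma abs_drift (a a0 M t T B : R) :
  Rabs (a - a0) <= M * Rabs t -> 0 <= M -> Rabs t <= T -> Rabs a0 <= B ->
  Rabs a <= B + M * T.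
Proof.
  intros H HM Ht HB. replace a with ((a - a0) + a0) by ring.
  eapply Rle_trans; [apply Rabs_triang|]. nra.
Qed.

(** In the norm weighted by [exp (- 4 * K * Rabs t)] each iteration halves the difference: the two
    coordinates cost [2 * K], and integrating the weight gains [1 / (4 * K)]. The first difference
    is the drift, at most [M * T]. *)
Lemma picard_contraction (p q : R -> R -> R) (M K x y T : R) :
  cont2 p -> cont2 q -> bounded_by M p -> bounded_by M q -> 0 < K ->
  lip_box p (Rabs x + Rabs y + M * T) K -> lip_box q (Rabs x + Rabs y + M * T) K ->
  forall n t, Rabs t <= T ->
  Rabs (fst (picard p q x y (S n)) t - fst (picard p q x y n) t)
    <= M * T * (1 / 2) ^ n * exp (4 * K * Rabs t) /\
  Rabs (snd (picard p q x y (S n)) t - snd (picard p q x y n) t)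
    <= M * T * (1 / 2) ^ n * exp (4 * K * Rabs t).
Proof.
  intros Hp Hq Bp Bq HK Lp Lq.
  pose proof (bounded_by_nonneg M p Bp) as HM.
  assert (Box : forall n t, Rabs t <= T ->
            Rabs (fst (picard p q x y n) t) <= Rabs x + Rabs y + M * T /\
            Rabs (snd (picard p q x y n) t) <= Rabs x + Rabs y + M * T).
  { intros n t Ht. destruct (picard_lipschitz p q M x y n 0 t) as [L1 L2]; auto.
    destruct (picard_initial p q x y n) as [E1 E2].
    rewrite E1, Rminus_0_r in L1. rewrite E2, Rminus_0_r in L2.
    pose proof (Rabs_pos x); pose proof (Rabs_pos y).
    split; eapply abs_drift; eauto; lra. }
  induction n as [|n IH]; intros t Ht.
  - destruct (picard_lipschitz p q M x y 1 0 t) as [L1 L2]; auto.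
    destruct (picard_initial p q x y 1) as [E1 E2].
    rewrite E1, Rminus_0_r in L1. rewrite E2, Rminus_0_r in L2.
    assert (1 <= exp (4 * K * Rabs t)).
    { rewrite <- exp_0. apply exp_mono. pose proof (Rabs_pos t). nra. }
    pose proof (Rabs_pos t).
    assert (M * Rabs t * 1 <= M * T * exp (4 * K * Rabs t))
      by (apply Rmult_le_compat; nra).
    simpl pow. simpl (fst (picard p q x y 0) t). simpl (snd (picard p q x y 0) t). lra.
  - assert (HT : 0 <= T) by (pose proof (Rabs_pos t); lra).
    assert (Hpow : 0 < (1 / 2) ^ n) by (apply pow_lt; lra).
    assert (Hc : 0 <= K * (2 * (M * T * (1 / 2) ^ n))).
    { repeat apply Rmult_le_pos; lra. }
    assert (Step : forall r, lip_box r (Rabs x + Rabs y + M * T) K ->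
      forall f g : R -> R, f 0 = g 0 ->
      (forall s, is_derive f s
         (r (fst (picard p q x y (S n)) s) (snd (picard p q x y (S n)) s))) ->
      (forall s, is_derive g s
         (r (fst (picard p q x y n) s) (snd (picard p q x y n) s))) ->
      Rabs (f t - g t) <= M * T * (1 / 2) ^ S n * exp (4 * K * Rabs t)).
    { intros r Lr f g E Df Dg.
      replace (M * T * (1 / 2) ^ S n) with (K * (2 * (M * T * (1 / 2) ^ n)) / (4 * K))
        by (simpl; field; lra).
      apply (abs_bound_by_exp (fun s => f s - g s)
               (fun s => r (fst (picard p q x y (S n)) s) (snd (picard p q x y (S n)) s) -
                         r (fst (picard p q x y n) s) (snd (picard p q x y n) s))
               _ (4 * K) T); auto; try lra.
      - intros s _. apply @is_derive_minus; auto.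
      - intros s Hs. destruct (Box n s Hs), (Box (S n) s Hs), (IH s Hs).
        eapply Rle_trans; [apply Lr; assumption|].
        rewrite (Rmult_assoc K). apply Rmult_le_compat_l; lra. }
    destruct (picard_initial p q x y (S n)) as [E1 E2].
    destruct (picard_initial p q x y (S (S n))) as [F1 F2].
    split; [apply (Step p Lp) | apply (Step q Lq)]; try congruence;
      intros s; apply (picard_derive p q x y); assumption.
Qed.

(** The limits [a] and [b] are taken pointwise on the whole line, so no local solutions have to be
    glued; only the rate of convergence depends on [T]. *)
Lemma ode_solution_exists (p q : R -> R -> R) (M x y : R) :
  Ck 1 p -> Ck 1 q -> bounded_by M p -> bounded_by M q ->
  exists a b : R -> R, a 0 = x /\ b 0 = y /\ solves p q a b.
Proof.
  intros Cp Cq Bp Bq. assert (Hp := Ck_cont2 _ _ Cp). assert (Hq := Ck_cont2 _ _ Cq).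
  pose proof (bounded_by_nonneg M p Bp) as HM.
  set (u := fun n t => fst (picard p q x y n) t).
  set (v := fun n t => snd (picard p q x y n) t).
  set (a := fun t => real (Lim_seq (fun n => u n t))).
  set (b := fun t => real (Lim_seq (fun n => v n t))).
  assert (Conv : forall T, exists C, 0 <= C /\ forall t, Rabs t <= T ->
     is_lim_seq (fun n => u n t) (a t) /\ is_lim_seq (fun n => v n t) (b t) /\
     forall n, Rabs (a t - u n t) <= C * (1 / 2) ^ n /\ Rabs (b t - v n t) <= C * (1 / 2) ^ n).
  { intros T. set (B := Rabs x + Rabs y + M * T).
    destruct (C1_lip_box p B Cp) as (K1 & HK1 & L1).
    destruct (C1_lip_box q B Cq) as (K2 & HK2 & L2).
    set (K := K1 + K2). set (C := M * T * exp (4 * K * T)).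
    assert (Inc := picard_contraction p q M K x y T Hp Hq Bp Bq ltac:(unfold K; lra)
      (lip_box_weaken p B K1 K ltac:(unfold K; lra) L1)
      (lip_box_weaken q B K2 K ltac:(unfold K; lra) L2)).
    (* [T] may be negative here; the absolute value keeps the constant nonnegative in that vacuous
       case too. *)
    exists (2 * Rabs C). split; [pose proof (Rabs_pos C); lra|]. intros t Ht.
    assert (HT : 0 <= T) by (pose proof (Rabs_pos t); lra).
    assert (HC : forall n, M * T * (1 / 2) ^ n * exp (4 * K * Rabs t) <= Rabs C * (1 / 2) ^ n).
    { intros n. assert (exp (4 * K * Rabs t) <= exp (4 * K * T)).
      { apply exp_mono. unfold K; nra. }
      assert (0 <= M * T * (1 / 2) ^ n)
        by (apply Rmult_le_pos; [nra | apply pow_le; lra]).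
      replace (Rabs C) with C.
      - unfold C. replace (M * T * exp (4 * K * T) * (1 / 2) ^ n)
          with (M * T * (1 / 2) ^ n * exp (4 * K * T)) by ring.
        apply Rmult_le_compat_l; auto.
      - symmetry; apply Rabs_pos_eq. unfold C. pose proof (exp_pos (4 * K * T)).
        apply Rmult_le_pos; nra. }
    destruct (geometric_limit (fun n => u n t) (Rabs C)) as [G1 G2].
    { intros n. eapply Rle_trans; [apply Inc, Ht | apply HC]. }
    destruct (geometric_limit (fun n => v n t) (Rabs C)) as [G3 G4].
    { intros n. eapply Rle_trans; [apply Inc, Ht | apply HC]. }
    split; [exact G1|]. split; [exact G3|]. intros n. split; auto. }
  assert (Lim : forall t, is_lim_seq (fun n => u n t) (a t) /\ is_lim_seq (fun n => v n t) (b t)).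
  { intros t. destruct (Conv (Rabs t)) as (C & _ & H).
    destruct (H t ltac:(lra)) as (H1 & H2 & _). auto. }
  (* A Lipschitz bound uniform in [n] passes to the pointwise limit. It makes [a] and [b] continuous
     and confines them to the same boxes as the iterates. *)
  assert (LipLim : forall (w : nat -> R -> R) (c : R -> R),
     (forall n s t, Rabs (w n t - w n s) <= M * Rabs (t - s)) ->
     (forall t, is_lim_seq (fun n => w n t) (c t)) ->
     forall s t, Rabs (c t - c s) <= M * Rabs (t - s)).
  { intros w c Hw Hc s t.
    assert (L : is_lim_seq (fun n => Rabs (w n t - w n s)) (Rabs (c t - c s))).
    { apply (is_lim_seq_abs _ (Finite (c t - c s))). apply is_lim_seq_minus'; auto. }
    refine (is_lim_seq_le _ _ _ _ _ L (is_lim_seq_const (M * Rabs (t - s)))).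
    intros n. apply Hw. }
  assert (La : forall s t, Rabs (a t - a s) <= M * Rabs (t - s)).
  { apply (LipLim u); [|apply Lim]. intros n s t. apply picard_lipschitz; auto. }
  assert (Lb : forall s t, Rabs (b t - b s) <= M * Rabs (t - s)).
  { apply (LipLim v); [|apply Lim]. intros n s t. apply picard_lipschitz; auto. }
  assert (LipC : forall c : R -> R, (forall s t, Rabs (c t - c s) <= M * Rabs (t - s)) ->
            forall t, continuous c t).
  { intros c Hc t. apply filterlim_locally. intros eps.
    assert (Hd : 0 < eps / (M + 1)) by (apply Rdiv_lt_0_compat; [apply cond_pos | lra]).
    exists (mkposreal _ Hd). intros s Hs.
    change (Rabs (s - t) < eps / (M + 1)) in Hs. change (Rabs (c s - c t) < eps).
    apply Rlt_div_r in Hs; [|lra]. specialize (Hc t s). pose proof (Rabs_pos (s - t)). nra. }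
  assert (Init : a 0 = x /\ b 0 = y).
  { destruct (Lim 0) as [H1 H2]. split.
    - apply is_lim_seq_unique in H1. unfold a.
      rewrite (Lim_seq_ext _ (fun _ => x)), Lim_seq_const; [reflexivity|].
      intros n. apply picard_initial.
    - unfold b.
      rewrite (Lim_seq_ext _ (fun _ => y)), Lim_seq_const; [reflexivity|].
      intros n. apply picard_initial. }
  (* Limit and derivative are not exchanged. The iterates are compared with the integral [I] of the
     field along the limit curve: [w (S n) - I] vanishes at 0 and its derivative is of order
     [(1 / 2) ^ n]. Hence [c = I], and the derivative of [I] is known. *)
  assert (Key : forall r, Ck 1 r -> forall (w : nat -> R -> R) (c : R -> R) (x0 : R),
     (forall t, is_lim_seq (fun n => w n t) (c t)) ->
     (forall n, w n 0 = x0) ->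
     (forall n t, is_derive (w (S n)) t (r (u n t) (v n t))) ->
     forall t, is_derive c t (r (a t) (b t))).
  { intros r Cr w c x0 Hw H0 Hd t.
    set (I := fun t => x0 + RInt (fun s => r (a s) (b s)) 0 t).
    assert (DI : forall t, is_derive I t (r (a t) (b t))).
    { intros s. apply (is_derive_primitive (fun s => r (a s) (b s))).
      intros s'. apply cont2_comp; auto. eapply Ck_cont2; eauto. }
    apply (is_derive_ext I); auto. clear t. intros t.
    set (T := Rabs t). destruct (Conv T) as (C & HC & Hconv).
    destruct (C1_lip_box r (Rabs x + Rabs y + M * T) Cr) as (K & HK & LK).
    assert (Box : forall s, Rabs s <= T -> Rabs (a s) <= Rabs x + Rabs y + M * T /\
              Rabs (b s) <= Rabs x + Rabs y + M * T).
    { intros s Hs. pose proof (Rabs_pos x); pose proof (Rabs_pos y).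
      specialize (La 0 s); specialize (Lb 0 s). destruct Init as [Ea Eb].
      rewrite Ea, Rminus_0_r in La. rewrite Eb, Rminus_0_r in Lb.
      split; eapply abs_drift; eauto; lra. }
    assert (Boxn : forall n s, Rabs s <= T -> Rabs (u n s) <= Rabs x + Rabs y + M * T /\
              Rabs (v n s) <= Rabs x + Rabs y + M * T).
    { intros n s Hs. pose proof (Rabs_pos x); pose proof (Rabs_pos y).
      destruct (picard_lipschitz p q M x y n 0 s) as [L1 L2]; auto.
      destruct (picard_initial p q x y n) as [E1 E2].
      rewrite E1, Rminus_0_r in L1. rewrite E2, Rminus_0_r in L2.
      unfold u, v. split; eapply abs_drift; eauto; lra. }
    assert (Est : forall n, Rabs (w (S n) t - I t) <= K * (2 * C) * T * (1 / 2) ^ n).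
    { intros n. replace (w (S n) t - I t) with ((w (S n) t - I t) - (w (S n) 0 - I 0)).
      2:{ rewrite H0. unfold I. rewrite RInt_point. unfold zero; simpl. ring. }
      replace (K * (2 * C) * T * (1 / 2) ^ n)
        with (K * (2 * C) * (1 / 2) ^ n * Rabs (t - 0)) by (rewrite Rminus_0_r; unfold T; ring).
      apply (MVT_abs_bound (fun t => w (S n) t - I t)
               (fun t => r (u n t) (v n t) - r (a t) (b t))).
      - intros s _. apply @is_derive_minus; auto.
      - intros s Hs'. assert (Hs : Rabs s <= T).
        { apply (between_abs_le 0 t T); auto; unfold T; try lra.
          rewrite Rabs_R0; apply Rabs_pos. }
        destruct (Box s Hs), (Boxn n s Hs), (Hconv s Hs) as (_ & _ & H4).
        destruct (H4 n) as [H5 H6].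
        eapply Rle_trans; [apply LK; assumption|].
        rewrite (Rabs_minus_sym (u n s)), (Rabs_minus_sym (v n s)).
        rewrite !Rmult_assoc. apply Rmult_le_compat_l; lra. }
    assert (LI : is_lim_seq (fun n => w (S n) t) (I t)).
    { apply is_lim_seq_spec. intros eps. simpl.
      destruct (pow_lt_1_zero (1 / 2) ltac:(rewrite Rabs_pos_eq; lra)
                  (eps / (K * (2 * C) * T + 1))) as [N HN].
      { assert (0 <= T) by apply Rabs_pos.
        apply Rdiv_lt_0_compat; [apply cond_pos |].
        assert (0 <= K * (2 * C) * T) by (apply Rmult_le_pos; nra). lra. }
      exists N. intros n Hn. specialize (HN n Hn). specialize (Est n).
      assert (Hpow : 0 < (1 / 2) ^ n) by (apply pow_lt; lra).
      rewrite Rabs_pos_eq in HN by lra.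
      assert (0 <= K * (2 * C) * T).
      { assert (0 <= T) by apply Rabs_pos. apply Rmult_le_pos; nra. }
      apply Rlt_div_r in HN; lra. }
    assert (Lc : is_lim_seq (fun n => w (S n) t) (c t)).
    { apply (is_lim_seq_incr_1 (fun n => w n t)), Hw. }
    apply is_lim_seq_unique in LI. apply is_lim_seq_unique in Lc.
    rewrite LI in Lc. injection Lc. auto. }
  exists a, b. destruct Init as [Ea Eb]. split; [exact Ea|]. split; [exact Eb|].
  intros t. split.
  - apply (Key p Cp u a x); [apply Lim | intros n; apply picard_initial |].
    intros n s. apply (picard_derive p q x y n); auto.
  - apply (Key q Cq v b y); [apply Lim | intros n; apply picard_initial |].
    intros n s. apply (picard_derive p q x y n); auto.
Qed.

Definition is_flow (p q : R -> R -> R) (X Y : R -> R -> R -> R) : Prop :=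
  forall x y, X 0 x y = x /\ Y 0 x y = y /\
    solves p q (fun t => X t x y) (fun t => Y t x y).

(** Choice picks one solution for each initial point, with no regularity in that point; regularity
    comes from the later estimates, which hold for all solutions. *)
Lemma flow_exists (p q : R -> R -> R) (M : R) :
  Ck 1 p -> Ck 1 q -> bounded_by M p -> bounded_by M q ->
  exists X Y, is_flow p q X Y.
Proof.
  intros Cp Cq Bp Bq.
  destruct (functional_choice (fun (z : R * R) (c : (R -> R) * (R -> R)) =>
      fst c 0 = fst z /\ snd c 0 = snd z /\ solves p q (fst c) (snd c))) as [F HF].
  { intros [x y]. destruct (ode_solution_exists p q M x y) as (a & b & H); auto.
    exists (a, b). exact H. }
  exists (fun t x y => fst (F (x, y)) t), (fun t x y => snd (F (x, y)) t).
  intros x y. exact (HF (x, y)).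
Qed.

(** * Dependence on the initial point *)

Lemma solves_drift (p q : R -> R -> R) (M : R) (a b : R -> R) (s t : R) :
  bounded_by M p -> bounded_by M q -> solves p q a b ->
  Rabs (a t - a s) <= M * Rabs (t - s) /\ Rabs (b t - b s) <= M * Rabs (t - s).
Proof.
  intros Bp Bq H. split.
  - apply (MVT_abs_bound a (fun r => p (a r) (b r))); intros r _; [apply H | apply Bp].
  - apply (MVT_abs_bound b (fun r => q (a r) (b r))); intros r _; [apply H | apply Bq].
Qed.

Lemma solves_box (p q : R -> R -> R) (M T B : R) (a b : R -> R) (t : R) :
  bounded_by M p -> bounded_by M q -> solves p q a b ->
  Rabs t <= T -> Rabs (a 0) <= B -> Rabs (b 0) <= B ->
  Rabs (a t) <= B + M * T /\ Rabs (b t) <= B + M * T.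
Proof.
  intros Bp Bq H Ht Ha Hb. destruct (solves_drift p q M a b 0 t Bp Bq H) as [L1 L2].
  rewrite Rminus_0_r in L1, L2. pose proof (bounded_by_nonneg M p Bp).
  split; eapply abs_drift; eauto.
Qed.

(** Up to time [T] both trajectories stay in the box of radius [B + M * T], where the field is
    Lipschitz; Gronwall with [d = 0] then applies to their difference. *)
Lemma solves_lipschitz (p q : R -> R -> R) (M T B : R) :
  Ck 1 p -> Ck 1 q -> bounded_by M p -> bounded_by M q -> 0 <= T ->
  exists C, 0 < C /\ forall a b a' b' : R -> R,
    solves p q a b -> solves p q a' b' ->
    Rabs (a 0) <= B -> Rabs (b 0) <= B -> Rabs (a' 0) <= B -> Rabs (b' 0) <= B ->
    forall t, Rabs t <= T ->
    Rabs (a' t - a t) + Rabs (b' t - b t) <= C * (Rabs (a' 0 - a 0) + Rabs (b' 0 - b 0)).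
Proof.
  intros Cp Cq Bp Bq HT.
  destruct (C1_lip_box p (B + M * T) Cp) as (K1 & HK1 & L1).
  destruct (C1_lip_box q (B + M * T) Cq) as (K2 & HK2 & L2).
  destruct (gronwall_pair (K1 + K2) T ltac:(lra) HT) as (C & HC & G).
  exists C. split; auto. intros a b a' b' S S' Ha Hb Ha' Hb' t Ht.
  rewrite <- (Rplus_0_r (Rabs (a' 0 - a 0) + Rabs (b' 0 - b 0))).
  apply (G (fun t => a' t - a t) (fun t => b' t - b t)
           (fun t => p (a' t) (b' t) - p (a t) (b t))
           (fun t => q (a' t) (b' t) - q (a t) (b t)) 0); auto; try lra; clear t Ht.
  - intros s _. apply (is_derive_minus a' a); [apply S' | apply S].
  - intros s _. apply (is_derive_minus b' b); [apply S' | apply S].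
  - intros s Hs. destruct (solves_box p q M T B a b s); auto.
    destruct (solves_box p q M T B a' b' s); auto. rewrite Rplus_0_r.
    apply (lip_box_weaken p (B + M * T) K1 (K1 + K2)); auto; lra.
  - intros s Hs. destruct (solves_box p q M T B a b s); auto.
    destruct (solves_box p q M T B a' b' s); auto. rewrite Rplus_0_r.
    apply (lip_box_weaken q (B + M * T) K2 (K1 + K2)); auto; lra.
Qed.

Lemma solves_unique (p q : R -> R -> R) (M : R) (a b a' b' : R -> R) (t : R) :
  Ck 1 p -> Ck 1 q -> bounded_by M p -> bounded_by M q ->
  solves p q a b -> solves p q a' b' -> a' 0 = a 0 -> b' 0 = b 0 ->
  a' t = a t /\ b' t = b t.
Proof.
  intros Cp Cq Bp Bq S S' Ea Eb.
  destruct (solves_lipschitz p q M (Rabs t) (Rabs (a 0) + Rabs (b 0)) Cp Cq Bp Bq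
              (Rabs_pos t)) as (C & HC & H).
  pose proof (Rabs_pos (a 0)); pose proof (Rabs_pos (b 0)).
  specialize (H a b a' b' S S'). rewrite Ea, Eb in H.
  specialize (H ltac:(lra) ltac:(lra) ltac:(lra) ltac:(lra) t ltac:(lra)).
  rewrite !Rminus_diag, Rabs_R0, Rplus_0_r, Rmult_0_r in H.
  pose proof (Rabs_pos (a' t - a t)); pose proof (Rabs_pos (b' t - b t)).
  split; apply Rminus_diag_uniq; apply Rabs_eq_0; lra.
Qed.

Lemma is_derive_shift (f : R -> R) (t s l : R) :
  is_derive f (t + s) l -> is_derive (fun r => f (t + r)) s l.
Proof.
  intros H. replace l with (1 * l) by ring.
  apply (is_derive_comp f (fun r => t + r)); auto.
  evar_last; [apply (is_derive_plus (fun _ => t) (fun r : R => r));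
              [apply @is_derive_const | apply @is_derive_id]|].
  unfold plus, zero, one; simpl; ring.
Qed.

(** As functions of [s] both sides solve the same equation and agree at [s = 0], so uniqueness
    applies. *)
Lemma flow_add (p q : R -> R -> R) (M : R) (X Y : R -> R -> R -> R) (t s x y : R) :
  Ck 1 p -> Ck 1 q -> bounded_by M p -> bounded_by M q -> is_flow p q X Y ->
  X (t + s) x y = X s (X t x y) (Y t x y) /\ Y (t + s) x y = Y s (X t x y) (Y t x y).
Proof.
  intros Cp Cq Bp Bq HF. destruct (HF x y) as (_ & _ & S).
  destruct (HF (X t x y) (Y t x y)) as (EX & EY & S').
  apply (solves_unique p q M (fun s => X s (X t x y) (Y t x y)) (fun s => Y s (X t x y) (Y t x y))
           (fun s => X (t + s) x y) (fun s => Y (t + s) x y)); auto.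
  - intros r. split.
    + apply (is_derive_shift (fun r => X r x y)), S.
    + apply (is_derive_shift (fun r => Y r x y)), S.
  - rewrite EX, Rplus_0_r. reflexivity.
  - rewrite EY, Rplus_0_r. reflexivity.
Qed.

(** * Joint continuity in time and initial point *)

Definition cont3 (F : R -> R -> R -> R) : Prop :=
  forall t x y,
    continuous (fun z : R * R * R => F (fst (fst z)) (snd (fst z)) (snd z)) (t, x, y).

Lemma cont3_eps (F : R -> R -> R -> R) :
  cont3 F <-> forall t x y eps, 0 < eps -> exists d, 0 < d /\
    forall t' x' y', Rabs (t' - t) < d -> Rabs (x' - x) < d -> Rabs (y' - y) < d ->
    Rabs (F t' x' y' - F t x y) < eps.
Proof.
  split; intros H t x y.
  - intros eps Heps. specialize (H t x y).
    assert (H' := proj1 (filterlim_locally _ _) H (mkposreal eps Heps)).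
    destruct H' as [d Hd]. exists d. split; [apply cond_pos|].
    intros t' x' y' H1 H2 H3.
    apply (Hd (t', x', y')). repeat split; assumption.
  - apply filterlim_locally. intros eps.
    destruct (H t x y eps (cond_pos eps)) as (d & Hd & Hb).
    exists (mkposreal d Hd). intros [[t' x'] y'] [[H1 H2] H3].
    apply Hb; assumption.
Qed.

Lemma cont3_comp {T : UniformSpace} (F : R -> R -> R -> R) (a b c : T -> R) (z : T) :
  cont3 F -> continuous a z -> continuous b z -> continuous c z ->
  continuous (fun z => F (a z) (b z) (c z)) z.
Proof.
  intros HF Ha Hb Hc.
  apply (continuous_comp_2 (fun z => (a z, b z)) c (fun w v => F (fst w) (snd w) v)); auto.
  apply (continuous_comp_2 a b (fun u v => (u, v))); auto.
  apply (continuous_ext (fun w : R * R => w)).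
  - intros [u v]. reflexivity.
  - apply continuous_id.
Qed.

(** The initial point is moved at the fixed time [t], by the Lipschitz estimate; then time is moved,
    at speed at most [M] per coordinate. In this order the Lipschitz estimate is wanted only up to
    [Rabs t]. *)
Lemma flow_cont3 (p q : R -> R -> R) (M : R) (X Y : R -> R -> R -> R) :
  Ck 1 p -> Ck 1 q -> bounded_by M p -> bounded_by M q -> is_flow p q X Y ->
  cont3 X /\ cont3 Y.
Proof.
  intros Cp Cq Bp Bq HF. pose proof (bounded_by_nonneg M p Bp) as HM.
  assert (H : forall t x y eps, 0 < eps -> exists d, 0 < d /\
    forall t' x' y', Rabs (t' - t) < d -> Rabs (x' - x) < d -> Rabs (y' - y) < d ->
    Rabs (X t' x' y' - X t x y) + Rabs (Y t' x' y' - Y t x y) < eps).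
  { intros t x y eps Heps.
    destruct (solves_lipschitz p q M (Rabs t) (Rabs x + Rabs y + 1) Cp Cq Bp Bq
                (Rabs_pos t)) as (C & HC & L).
    (* [2 * M] accounts for the drift of the two coordinates, [2 * C] for the displacements of [x]
       and [y]. *)
    set (D := 2 * M + 2 * C).
    assert (Hd : 0 < eps / D) by (apply Rdiv_lt_0_compat; unfold D; lra).
    exists (Rmin 1 (eps / D)). split; [apply Rmin_glb_lt; lra|].
    intros t' x' y' Ht Hx Hy.
    assert (Hmin1 := Rmin_l 1 (eps / D)). assert (Hmin2 := Rmin_r 1 (eps / D)).
    destruct (HF x y) as (E1 & E2 & S). destruct (HF x' y') as (E1' & E2' & S').
    pose proof (Rabs_pos x); pose proof (Rabs_pos y).
    assert (Rabs x' <= Rabs x + Rabs y + 1).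
    { replace x' with ((x' - x) + x) by ring. eapply Rle_trans; [apply Rabs_triang|]. lra. }
    assert (Rabs y' <= Rabs x + Rabs y + 1).
    { replace y' with ((y' - y) + y) by ring. eapply Rle_trans; [apply Rabs_triang|]. lra. }
    specialize (L _ _ _ _ S S'). simpl in L. rewrite E1, E2, E1', E2' in L.
    specialize (L ltac:(lra) ltac:(lra) ltac:(lra) ltac:(lra) t ltac:(lra)).
    destruct (solves_drift p q M _ _ t t' Bp Bq S') as [D1 D2]. simpl in D1, D2.
    replace (X t' x' y' - X t x y) with ((X t' x' y' - X t x' y') + (X t x' y' - X t x y)) by ring.
    replace (Y t' x' y' - Y t x y) with ((Y t' x' y' - Y t x' y') + (Y t x' y' - Y t x y)) by ring.
    pose proof (Rabs_triang (X t' x' y' - X t x' y') (X t x' y' - X t x y)).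
    pose proof (Rabs_triang (Y t' x' y' - Y t x' y') (Y t x' y' - Y t x y)).
    assert (M * Rabs (t' - t) <= M * (eps / D)) by (apply Rmult_le_compat_l; lra).
    assert (C * (Rabs (x' - x) + Rabs (y' - y)) < C * (2 * (eps / D)))
      by (apply Rmult_lt_compat_l; lra).
    assert (D * (eps / D) = eps) by (field; unfold D; lra).
    unfold D in *. lra. }
  split; apply cont3_eps; intros t x y eps Heps;
    destruct (H t x y eps Heps) as (d & Hd & Hb); exists d; split; auto;
    intros t' x' y' Ht Hx Hy; specialize (Hb t' x' y' Ht Hx Hy);
    pose proof (Rabs_pos (X t' x' y' - X t x y));
    pose proof (Rabs_pos (Y t' x' y' - Y t x y)); lra.
Qed.

(** * Differentiability in the initial point *)

Definition dquot (F : R -> R -> R -> R) (al be h t x y : R) : R :=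
  (F t (x + h * al) (y + h * be) - F t x y) / h.

Definition dquot_cauchy (F : R -> R -> R -> R) (al be : R) : Prop :=
  forall T B, 0 <= T -> exists C, 0 < C /\
  forall t x y h k, Rabs t <= T -> Rabs x <= B -> Rabs y <= B ->
    h <> 0 -> k <> 0 -> Rabs h <= 1 -> Rabs k <= 1 ->
    Rabs (dquot F al be h t x y - dquot F al be k t x y) <= C * (Rabs h + Rabs k).

Lemma is_derive_div_const (f : R -> R) (t l h : R) :
  is_derive f t l -> is_derive (fun s => f s / h) t (l / h).
Proof.
  intros H. apply (is_derive_ext (fun s => / h * f s)).
  - intros s. unfold Rdiv. apply Rmult_comm.
  - unfold Rdiv. rewrite Rmult_comm. apply is_derive_scal, H.
Qed.

(** [D] and [D'] stand for the increments of a field for the steps [h] and [k], and [(a, b)],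
    [(a', b')] for the displacements. Both are expanded at one base point, so the linear parts share
    the coefficients [A1], [A2] and combine; the rest is Taylor error. *)
Lemma taylor_quotient_diff (A1 A2 a b a' b' D D' K0 e e' h k : R) :
  h <> 0 -> k <> 0 -> Rabs A1 <= K0 -> Rabs A2 <= K0 ->
  Rabs (D - (A1 * a + A2 * b)) <= e * Rabs h ->
  Rabs (D' - (A1 * a' + A2 * b')) <= e' * Rabs k ->
  Rabs (D / h - D' / k)
    <= K0 * (Rabs (a / h - a' / k) + Rabs (b / h - b' / k)) + (e + e').
Proof.
  intros Hh Hk H1 H2 HD HD'.
  replace (D / h - D' / k) with
    ((A1 * (a / h - a' / k) + A2 * (b / h - b' / k))
     + ((D - (A1 * a + A2 * b)) / h - (D' - (A1 * a' + A2 * b')) / k)) by (field; auto).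
  eapply Rle_trans; [apply Rabs_triang|].
  assert (Q : forall z c j, j <> 0 -> Rabs z <= c * Rabs j -> Rabs (z / j) <= c).
  { intros z c j Hj Hz. rewrite Rabs_div by auto. apply Rle_div_l; auto.
    apply Rabs_pos_lt; auto. }
  apply Rplus_le_compat.
  - eapply Rle_trans; [apply Rabs_triang|]. rewrite !Rabs_mult, Rmult_plus_distr_l.
    apply Rplus_le_compat; apply Rmult_le_compat_r; auto; apply Rabs_pos.
  - eapply Rle_trans; [apply Rabs_triang|]. rewrite Rabs_Ropp.
    apply Rplus_le_compat; apply Q; auto.
Qed.

(* The difference quotients of the flow solve, up to an error of order
   |h| + |k|, the same linear equation with the same initial value. *)
Lemma flow_dquot_cauchy (p q : R -> R -> R) (M : R) (X Y : R -> R -> R -> R) (al be : R) :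
  Ck 2 p -> Ck 2 q -> bounded_by M p -> bounded_by M q -> is_flow p q X Y ->
  Rabs al <= 1 -> Rabs be <= 1 ->
  dquot_cauchy X al be /\ dquot_cauchy Y al be.
Proof.
  intros Cp Cq Bp Bq HF Hal Hbe.
  assert (Cp1 := Ck_pred _ _ Cp). assert (Cq1 := Ck_pred _ _ Cq).
  assert (Main : forall T B, 0 <= T -> exists C, 0 < C /\
    forall t x y h k, Rabs t <= T -> Rabs x <= B -> Rabs y <= B ->
    h <> 0 -> k <> 0 -> Rabs h <= 1 -> Rabs k <= 1 ->
    Rabs (dquot X al be h t x y - dquot X al be k t x y) +
    Rabs (dquot Y al be h t x y - dquot Y al be k t x y) <= C * (Rabs h + Rabs k)).
  2:{ split; intros T B HT; destruct (Main T B HT) as (C & HC & H); exists C; split; auto;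
      intros t x y h k H1 H2 H3 H4 H5 H6 H7;
      specialize (H t x y h k H1 H2 H3 H4 H5 H6 H7);
      pose proof (Rabs_pos (dquot X al be h t x y - dquot X al be k t x y));
      pose proof (Rabs_pos (dquot Y al be h t x y - dquot Y al be k t x y)); lra. }
  (* Shifted initial points lie within [B + 1], since steps and direction are at most 1; [M * T] is
     the drift. *)
  intros T B HT. set (B' := B + 1 + M * T).
  destruct (solves_lipschitz p q M T (B + 1) Cp1 Cq1 Bp Bq HT) as (L & HL & Lip).
  destruct (C2_taylor_box p B' Cp) as (Kp & HKp & Tp).
  destruct (C2_taylor_box q B' Cq) as (Kq & HKq & Tq).
  destruct (cont2_bounded (pd1 p) B' (Ck_cont2 1 _ (proj1 (proj2 (proj2 Cp))))) as (N1 & HN1 & P1).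
  destruct (cont2_bounded (pd2 p) B' (Ck_cont2 1 _ (proj2 (proj2 (proj2 Cp))))) as (N2 & HN2 & P2).
  destruct (cont2_bounded (pd1 q) B' (Ck_cont2 1 _ (proj1 (proj2 (proj2 Cq))))) as (N3 & HN3 & Q1).
  destruct (cont2_bounded (pd2 q) B' (Ck_cont2 1 _ (proj2 (proj2 (proj2 Cq))))) as (N4 & HN4 & Q2).
  set (N := N1 + N2 + N3 + N4). set (K := Kp + Kq).
  destruct (gronwall_pair N T ltac:(unfold N; lra) HT) as (G & HG & Gr).
  (* The Taylor constant times the square of the separation [2 * L * Rabs j] of the trajectories, up
     to [Rabs j ^ 2]; one factor [Rabs j] is used up by the division by [j]. *)
  set (E := K * (2 * L) ^ 2).
  assert (HE : 0 < E) by (unfold E, K; apply Rmult_lt_0_compat; [lra | apply pow_lt; lra]).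
  exists (G * E). split; [apply Rmult_lt_0_compat; auto|].
  intros t x y h k Ht Hx Hy Hh Hk Hh1 Hk1.
  assert (Shift : forall z c j, Rabs z <= B -> Rabs c <= 1 -> Rabs j <= 1 ->
             Rabs (z + j * c) <= B + 1).
  { intros z c j Hz Hc Hj. eapply Rle_trans; [apply Rabs_triang|].
    rewrite Rabs_mult. pose proof (Rabs_pos c); pose proof (Rabs_pos j). nra. }
  assert (Bx : forall j, Rabs j <= 1 -> forall s, Rabs s <= T ->
     Rabs (X s (x + j * al) (y + j * be)) <= B' /\ Rabs (Y s (x + j * al) (y + j * be)) <= B').
  { intros j Hj s Hs. destruct (HF (x + j * al) (y + j * be)) as (E1 & E2 & S).
    apply (solves_box p q M T (B + 1) _ _ s Bp Bq S Hs); simpl; [rewrite E1|rewrite E2]; auto. }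
  assert (B0 : forall s, Rabs s <= T -> Rabs (X s x y) <= B' /\ Rabs (Y s x y) <= B').
  { intros s Hs. specialize (Bx 0 ltac:(rewrite Rabs_R0; lra) s Hs).
    rewrite !Rmult_0_l, !Rplus_0_r in Bx. exact Bx. }
  assert (Sep : forall j, Rabs j <= 1 -> forall s, Rabs s <= T ->
     Rabs (X s (x + j * al) (y + j * be) - X s x y) +
     Rabs (Y s (x + j * al) (y + j * be) - Y s x y) <= 2 * L * Rabs j).
  { intros j Hj s Hs. destruct (HF x y) as (E1 & E2 & S).
    destruct (HF (x + j * al) (y + j * be)) as (E1' & E2' & S').
    specialize (Lip _ _ _ _ S S'). simpl in Lip. rewrite E1, E2, E1', E2' in Lip.
    specialize (Lip ltac:(lra) ltac:(lra) ltac:(auto) ltac:(auto) s Hs).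
    eapply Rle_trans; [apply Lip|].
    replace (x + j * al - x) with (j * al) by ring.
    replace (y + j * be - y) with (j * be) by ring. rewrite !Rabs_mult.
    replace (2 * L * Rabs j) with (L * (Rabs j * 1 + Rabs j * 1)) by ring.
    apply Rmult_le_compat_l; [lra|]. pose proof (Rabs_pos j).
    apply Rplus_le_compat; apply Rmult_le_compat_l; auto. }
  assert (Quad : forall j, Rabs j <= 1 -> forall s, Rabs s <= T -> forall K', 0 <= K' <= K ->
     K' * (Rabs (X s (x + j * al) (y + j * be) - X s x y) +
     Rabs (Y s (x + j * al) (y + j * be) - Y s x y)) ^ 2 <= E * Rabs j * Rabs j).
  { intros j Hj s Hs K' HK'. specialize (Sep j Hj s Hs). unfold E.
    replace (K * (2 * L) ^ 2 * Rabs j * Rabs j) with (K * (2 * L * Rabs j) ^ 2) by ring.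
    apply Rmult_le_compat; try lra; [apply pow2_ge_0|].
    apply pow_incr. split; auto. apply Rplus_le_le_0_compat; apply Rabs_pos. }
  assert (Der : forall j s, j <> 0 ->
     is_derive (fun s => dquot X al be j s x y) s
       ((p (X s (x + j * al) (y + j * be)) (Y s (x + j * al) (y + j * be)) -
         p (X s x y) (Y s x y)) / j) /\
     is_derive (fun s => dquot Y al be j s x y) s
       ((q (X s (x + j * al) (y + j * be)) (Y s (x + j * al) (y + j * be)) -
         q (X s x y) (Y s x y)) / j)).
  { intros j s Hj. destruct (HF x y) as (_ & _ & S).
    destruct (HF (x + j * al) (y + j * be)) as (_ & _ & S').
    split; apply is_derive_div_const.
    - apply (is_derive_minus (fun s => X s (x + j * al) (y + j * be)) (fun s => X s x y));
        [apply S' | apply S].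
    - apply (is_derive_minus (fun s => Y s (x + j * al) (y + j * be)) (fun s => Y s x y));
        [apply S' | apply S]. }
  assert (Init : forall j, j <> 0 -> dquot X al be j 0 x y = al /\ dquot Y al be j 0 x y = be).
  { intros j Hj. destruct (HF x y) as (E1 & E2 & _).
    destruct (HF (x + j * al) (y + j * be)) as (E1' & E2' & _).
    unfold dquot. rewrite E1, E2, E1', E2'. split; field; auto. }
  assert (HE' : 0 <= E * Rabs h + E * Rabs k).
  { pose proof (Rabs_pos h); pose proof (Rabs_pos k). nra. }
  assert (F : forall r Kr, 0 <= Kr <= K ->
     (forall a b a' b', Rabs a <= B' -> Rabs b <= B' -> Rabs a' <= B' -> Rabs b' <= B' ->
        Rabs (r a' b' - r a b - (pd1 r a b * (a' - a) + pd2 r a b * (b' - b)))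
        <= Kr * (Rabs (a' - a) + Rabs (b' - b)) ^ 2) ->
     (forall a b, Rabs a <= B' -> Rabs b <= B' -> Rabs (pd1 r a b) <= N) ->
     (forall a b, Rabs a <= B' -> Rabs b <= B' -> Rabs (pd2 r a b) <= N) ->
     forall s, Rabs s <= T ->
     Rabs ((r (X s (x + h * al) (y + h * be)) (Y s (x + h * al) (y + h * be)) -
         r (X s x y) (Y s x y)) / h -
         (r (X s (x + k * al) (y + k * be)) (Y s (x + k * al) (y + k * be)) -
         r (X s x y) (Y s x y)) / k)
     <= N * (Rabs (dquot X al be h s x y - dquot X al be k s x y) +
             Rabs (dquot Y al be h s x y - dquot Y al be k s x y)) + (E * Rabs h + E * Rabs k)).
  { intros r Kr HKr Tr N1r N2r s Hs.
    destruct (B0 s Hs), (Bx h Hh1 s Hs), (Bx k Hk1 s Hs).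
    unfold dquot. eapply taylor_quotient_diff with
      (A1 := pd1 r (X s x y) (Y s x y)) (A2 := pd2 r (X s x y) (Y s x y)); auto.
    - eapply Rle_trans; [apply Tr; assumption | apply Quad; assumption].
    - eapply Rle_trans; [apply Tr; assumption | apply Quad; assumption]. }
  (* At time 0 the quotients equal [al] and [be] for every step, so Gronwall is left with the error
     term alone. *)
  replace (G * E * (Rabs h + Rabs k)) with
    (G * (Rabs (dquot X al be h 0 x y - dquot X al be k 0 x y) +
          Rabs (dquot Y al be h 0 x y - dquot Y al be k 0 x y) + (E * Rabs h + E * Rabs k))).
  2:{ destruct (Init h Hh) as [-> ->]. destruct (Init k Hk) as [-> ->].
      rewrite !Rminus_diag, Rabs_R0. ring. }
  refine (Gr (fun s => dquot X al be h s x y - dquot X al be k s x y)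
             (fun s => dquot Y al be h s x y - dquot Y al be k s x y)
             _ _ _ HE' _ _ _ _ t Ht).
  - intros s _. apply (is_derive_minus (fun s => dquot X al be h s x y)
                         (fun s => dquot X al be k s x y));
      [exact (proj1 (Der h s Hh)) | exact (proj1 (Der k s Hk))].
  - intros s _. apply (is_derive_minus (fun s => dquot Y al be h s x y)
                         (fun s => dquot Y al be k s x y));
      [exact (proj2 (Der h s Hh)) | exact (proj2 (Der k s Hk))].
  - apply (F p Kp); [unfold K; lra | exact Tp | |]; intros a b Ha Hb;
      [specialize (P1 a b Ha Hb) | specialize (P2 a b Ha Hb)]; unfold N; lra.
  - apply (F q Kq); [unfold K; lra | exact Tq | |]; intros a b Ha Hb;
      [specialize (Q1 a b Ha Hb) | specialize (Q2 a b Ha Hb)]; unfold N; lra.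
Qed.

Lemma le_of_le_geometric (a b c : R) :
  (forall n, a <= b + c * (1 / 2) ^ n) -> a <= b.
Proof.
  intros H.
  assert (L : is_lim_seq (fun n => b + c * (1 / 2) ^ n) (b + c * 0)).
  { apply is_lim_seq_plus'; [apply is_lim_seq_const|].
    apply (is_lim_seq_scal_l (fun n => (1 / 2) ^ n) c 0), is_lim_seq_geom.
    rewrite Rabs_pos_eq; lra. }
  rewrite Rmult_0_r, Rplus_0_r in L.
  exact (is_lim_seq_le _ _ _ _ H (is_lim_seq_const a) L).
Qed.

(** The limit is taken along the steps [(1 / 2) ^ n] only; the Cauchy estimate then carries the rate
    over to every small [h]. *)
Lemma dquot_cauchy_derivative (F : R -> R -> R -> R) (al be : R) :
  cont3 F -> dquot_cauchy F al be ->
  exists V, cont3 V /\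
    forall t x y, is_derive (fun h => F t (x + h * al) (y + h * be)) 0 (V t x y).
Proof.
  intros HF HC.
  set (V := fun t x y => real (Lim_seq (fun n => dquot F al be ((1 / 2) ^ n) t x y))).
  assert (Pow : forall n, 0 < (1 / 2) ^ n <= 1).
  { intros n. split; [apply pow_lt; lra|]. 
    pose proof (pow_incr (1 / 2) 1 n ltac:(lra)) as H. rewrite pow1 in H. exact H. }
  assert (Near : forall T B, 0 <= T -> exists C, 0 < C /\
     forall t x y h, Rabs t <= T -> Rabs x <= B -> Rabs y <= B -> h <> 0 -> Rabs h <= 1 ->
     Rabs (dquot F al be h t x y - V t x y) <= C * Rabs h).
  { intros T B HT. destruct (HC T B HT) as (C & HCp & H). exists C. split; auto.
    intros t x y h Ht Hx Hy Hh Hh1.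
    assert (HP : forall n, (1 / 2) ^ n <> 0 /\ Rabs ((1 / 2) ^ n) <= 1 /\
                   Rabs ((1 / 2) ^ n) = (1 / 2) ^ n).
    { intros n. specialize (Pow n). rewrite Rabs_pos_eq; lra. }
    destruct (geometric_limit (fun n => dquot F al be ((1 / 2) ^ n) t x y) (2 * C))
      as [_ G].
    { intros n. destruct (HP n) as (P1 & P2 & P3), (HP (S n)) as (P4 & P5 & P6).
      eapply Rle_trans; [apply H; auto|]. rewrite P3, P6. simpl.
      assert (0 < C * (1 / 2) ^ n) by (apply Rmult_lt_0_compat; [auto | apply Pow]). lra. }
    (* [C] from the Cauchy estimate against the step [(1 / 2) ^ n], and [4 * C] from the convergence
       of these quotients to [V]. *)
    apply (le_of_le_geometric _ _ (5 * C)). intros n.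
    specialize (G n). fold (V t x y) in G. destruct (HP n) as (P1 & P2 & P3).
    specialize (H t x y h ((1 / 2) ^ n) Ht Hx Hy Hh P1 Hh1 P2). rewrite P3 in H.
    replace (dquot F al be h t x y - V t x y) with
      ((dquot F al be h t x y - dquot F al be ((1 / 2) ^ n) t x y)
       - (V t x y - dquot F al be ((1 / 2) ^ n) t x y)) by ring.
    eapply Rle_trans; [apply Rabs_triang|]. rewrite Rabs_Ropp. lra. }
  exists V. split.
  - apply cont3_eps. intros t x y eps Heps.
    destruct (Near (Rabs t + 1) (Rabs x + Rabs y + 1)) as (C & HCp & H).
    { pose proof (Rabs_pos t); lra. }
    (* With this fixed step the quotient is within [eps / 4] of [V] near the point, and it is
       continuous. *)
    set (h := Rmin 1 (eps / (4 * C))).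
    assert (Hh : 0 < h) by (apply Rmin_glb_lt; [lra | apply Rdiv_lt_0_compat; lra]).
    assert (Hh1 : h <= 1) by apply Rmin_l.
    assert (HCh : C * h <= eps / 4).
    { apply Rle_trans with (C * (eps / (4 * C))).
      - apply Rmult_le_compat_l; [lra | apply Rmin_r].
      - right; field; lra. }
    assert (Cd : cont3 (dquot F al be h)).
    { intros t0 x0 y0. unfold dquot, Rdiv.
      assert (C1 : continuous (fun z : R * R * R => fst (fst z)) (t0, x0, y0)).
      { apply (continuous_comp fst fst); apply continuous_fst. }
      assert (C2 : continuous (fun z : R * R * R => snd (fst z)) (t0, x0, y0)).
      { apply (continuous_comp fst snd); [apply continuous_fst | apply continuous_snd]. }
      assert (C3 : continuous (fun z : R * R * R => snd z) (t0, x0, y0)).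
      { apply continuous_snd. }
      apply (continuous_mult (K := R_AbsRing)
               (fun z : R * R * R => F (fst (fst z)) (snd (fst z) + h * al) (snd z + h * be) -
                          F (fst (fst z)) (snd (fst z)) (snd z))); [|apply continuous_const].
      apply (continuous_minus (V := R_NormedModule)
               (fun z : R * R * R => F (fst (fst z)) (snd (fst z) + h * al) (snd z + h * be)));
        [|apply HF].
      apply cont3_comp; auto.
      - apply (continuous_plus (V := R_NormedModule)); [exact C2 | apply continuous_const].
      - apply (continuous_plus (V := R_NormedModule)); [exact C3 | apply continuous_const]. }
    destruct (proj1 (cont3_eps _) Cd t x y (eps / 4) ltac:(lra)) as (d & Hd & Hcont).
    exists (Rmin 1 d). split; [apply Rmin_glb_lt; lra|]. intros t' x' y' Ht Hx Hy.
    assert (M1 := Rmin_l 1 d). assert (M2 := Rmin_r 1 d).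
    assert (Tri : forall a b, Rabs (b - a) < 1 -> Rabs b <= Rabs a + 1).
    { intros a b Hab. replace b with ((b - a) + a) by ring.
      eapply Rle_trans; [apply Rabs_triang|]. lra. }
    pose proof (Tri t t' ltac:(lra)). pose proof (Tri x x' ltac:(lra)).
    pose proof (Tri y y' ltac:(lra)). pose proof (Rabs_pos x). pose proof (Rabs_pos y).
    assert (Ah : Rabs h = h) by (apply Rabs_pos_eq; lra).
    pose proof (H t x y h ltac:(lra) ltac:(lra) ltac:(lra) ltac:(lra) ltac:(lra)) as N1.
    pose proof (H t' x' y' h ltac:(lra) ltac:(lra) ltac:(lra) ltac:(lra) ltac:(lra)) as N2.
    specialize (Hcont t' x' y' ltac:(lra) ltac:(lra) ltac:(lra)).
    rewrite Ah in N1, N2.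
    replace (V t' x' y' - V t x y) with
      ((dquot F al be h t' x' y' - dquot F al be h t x y)
       + ((dquot F al be h t x y - V t x y)
       - (dquot F al be h t' x' y' - V t' x' y'))) by ring.
    eapply Rle_lt_trans; [apply Rabs_triang|].
    pose proof (Rabs_triang (dquot F al be h t x y - V t x y)
                  (- (dquot F al be h t' x' y' - V t' x' y'))) as N3.
    rewrite Rabs_Ropp in N3. unfold Rminus in *. lra.
  - intros t x y. apply is_derive_Reals. intros eps Heps.
    destruct (Near (Rabs t) (Rabs x + Rabs y) (Rabs_pos t)) as (C & HCp & H).
    assert (Hd : 0 < Rmin 1 (eps / C)).
    { apply Rmin_glb_lt; [lra | apply Rdiv_lt_0_compat; lra]. }
    exists (mkposreal _ Hd). intros h Hh Hhd. simpl in Hhd.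
    assert (M1 := Rmin_l 1 (eps / C)). assert (M2 := Rmin_r 1 (eps / C)).
    pose proof (Rabs_pos x). pose proof (Rabs_pos y).
    specialize (H t x y h ltac:(lra) ltac:(lra) ltac:(lra) Hh ltac:(lra)).
    unfold dquot in H. rewrite Rplus_0_l, !Rmult_0_l, !Rplus_0_r.
    eapply Rle_lt_trans; [apply H|].
    apply Rlt_le_trans with (C * (eps / C)); [apply Rmult_lt_compat_l; lra|].
    right; field; lra.
Qed.

Lemma flow_C1 (p q : R -> R -> R) (M : R) (X Y : R -> R -> R -> R) (al be : R) :
  Ck 2 p -> Ck 2 q -> bounded_by M p -> bounded_by M q -> is_flow p q X Y ->
  Rabs al <= 1 -> Rabs be <= 1 ->
  exists X' Y', cont3 X' /\ cont3 Y' /\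
    forall t x y,
      is_derive (fun h => X t (x + h * al) (y + h * be)) 0 (X' t x y) /\
      is_derive (fun h => Y t (x + h * al) (y + h * be)) 0 (Y' t x y).
Proof.
  intros Cp Cq Bp Bq HF Hal Hbe.
  destruct (flow_cont3 p q M X Y) as [CX CY]; auto using Ck_pred.
  destruct (flow_dquot_cauchy p q M X Y al be) as [QX QY]; auto.
  destruct (dquot_cauchy_derivative X al be CX QX) as (X' & CX' & DX).
  destruct (dquot_cauchy_derivative Y al be CY QY) as (Y' & CY' & DY).
  exists X', Y'. auto.
Qed.

(** * Transport along the flow *)

(** Continuous partial derivatives give total differentiability, hence the continuity of [f] that
    [Ck] demands. *)
Lemma C1_intro (f f1 f2 : R -> R -> R) :
  (forall x y, is_derive (fun t => f t y) x (f1 x y)) ->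
  (forall x y, is_derive (fun t => f x t) y (f2 x y)) ->
  cont2 f1 -> cont2 f2 -> Ck 1 f.
Proof.
  intros D1 D2 C1 C2. apply (Ck_S_intro 0 f f1 f2); auto.
  intros x y.
  apply (filterdiff_continuous (K := R_AbsRing)
           (U := prod_NormedModule R_AbsRing R_NormedModule R_NormedModule) (V := R_NormedModule) (fun p : R * R => f (fst p) (snd p))). eexists.
  apply (is_derive_filterdiff f x y f1 (f2 x y)).
  - apply filter_forall. intros u. apply D1.
  - apply D2.
  - apply C1.
Qed.

(** * Parameter integrals and potentials *)

Lemma cont2_section_l (f : R -> R -> R) (x : R) : cont2 f -> forall y, continuous (f x) y.
Proof.
  intros Hf y. apply (cont2_comp f (fun _ => x) (fun y => y)); auto.
  - apply continuous_const.
  - apply continuous_id.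
Qed.

(** The Leibniz rule with a moving end: a constant [b] serves the potential, and [- u] on a
    coordinate line serves the transport equation. *)
Lemma is_derive_RInt_upper (f f1 : R -> R -> R) (b : R -> R) (x db : R) :
  cont2 f -> cont2 f1 -> (forall x s, is_derive (fun x => f x s) x (f1 x s)) ->
  is_derive b x db ->
  is_derive (fun x => RInt (fun s => f x s) 0 (b x)) x
    (RInt (fun s => f1 x s) 0 (b x) + f x (b x) * db).
Proof.
  intros Cf C1 D1 Db.
  assert (ED : forall x s, Derive (fun x => f x s) x = f1 x s)
    by (intros; apply is_derive_unique, D1).
  assert (C2d : forall x' t,
     continuity_2d_pt (fun u v : R => Derive (fun z : R => f z v) u) x' t).
  { intros x' t. apply (continuity_2d_pt_ext f1); [intros; symmetry; apply ED|].
    apply cont2_pt, C1. }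
  assert (Int : forall x a b, ex_RInt (fun s => f x s) a b).
  { intros x' a' b'. apply @ex_RInt_continuous. intros; apply cont2_section_l, Cf. }
  rewrite (RInt_ext _ (fun s => Derive (fun u : R => f u s) x)) by (intros; symmetry; apply ED).
  apply is_derive_RInt_param_bound_comp_aux3; auto.
  - apply filter_forall. auto.
  - exists (mkposreal 1 Rlt_0_1). apply filter_forall. auto.
  - exists (mkposreal 1 Rlt_0_1). apply filter_forall. intros x' t _. eexists; apply D1.
  - exists (mkposreal 1 Rlt_0_1). auto.
  - apply continuity_pt_filterlim. apply (cont2_section_l f x Cf).
Qed.

(** The form is integrated from the origin along the horizontal axis and then vertically. The
    [y]-derivative is immediate; the [x]-derivative is [A x 0] plus the integral of [pd1 B = pd2 A],
    which is [A x y - A x 0]. *)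
Lemma poincare_potential (A B : R -> R -> R) :
  Ck 1 A -> Ck 1 B -> (forall x y, pd2 A x y = pd1 B x y) ->
  exists v, Ck 1 v /\ (forall x y, pd1 v x y = A x y /\ pd2 v x y = B x y).
Proof.
  intros CA CB HAB. assert (cA := Ck_cont2 _ _ CA). assert (cB := Ck_cont2 _ _ CB).
  set (v := fun x y => RInt (fun s => A s 0) 0 x + RInt (fun s => B x s) 0 y).
  assert (D1 : forall x y, is_derive (fun t => v t y) x (A x y)).
  (* The vanishing product is the Leibniz term of the upper bound [y], constant in [x]. *)
  { intros x y. replace (A x y) with (A x 0 + (RInt (fun s => pd1 B x s) 0 y + B x y * 0)).
    - apply (is_derive_plus (fun x => RInt (fun s => A s 0) 0 x)
               (fun x => RInt (fun s => B x s) 0 y)).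
      + apply (is_derive_ext (fun x => 0 + RInt (fun s => A s 0) 0 x));
          [intros; apply Rplus_0_l|].
        apply (is_derive_primitive (fun s => A s 0)). intros s.
        apply (cont2_comp A (fun s => s) (fun _ => 0)); auto;
          [apply continuous_id | apply continuous_const].
      + apply (is_derive_RInt_upper B (pd1 B) (fun _ => y) x 0); auto.
        * apply CB.
        * intros; apply (pd1_is_derive 0); auto.
        * apply @is_derive_const.
    - rewrite (RInt_ext _ (fun s => pd2 A x s)) by (intros; symmetry; apply HAB).
      assert (E := is_RInt_derive (fun s => A x s) (fun s => pd2 A x s) 0 y).
      rewrite (is_RInt_unique _ _ _ _
        (E ltac:(intros; apply (pd2_is_derive 0); auto)
           ltac:(intros; apply cont2_section_l, CA))).
      unfold minus, plus, opp; simpl. ring. }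
  assert (D2 : forall x y, is_derive (fun t => v x t) y (B x y)).
  { intros x y. apply (is_derive_primitive (fun s => B x s)), (cont2_section_l B x cB). }
  exists v. split.
  - apply (C1_intro v A B); auto.
  - intros x y. split; apply is_derive_unique; [apply D1 | apply D2].
Qed.

Lemma cont2_eps (f : R -> R -> R) :
  (forall x y eps, 0 < eps -> exists d, 0 < d /\
     forall x' y', Rabs (x' - x) < d -> Rabs (y' - y) < d -> Rabs (f x' y' - f x y) < eps) ->
  cont2 f.
Proof.
  intros H x y. apply filterlim_locally. intros eps.
  destruct (H x y eps (cond_pos eps)) as (d & Hd & Hb).
  exists (mkposreal d Hd). intros [x' y'] [H1 H2]. apply Hb; assumption.
Qed.

Lemma cont3_section_1 (k : R -> R -> R -> R) (x y : R) :
  cont3 k -> forall s, continuous (fun s => k s x y) s.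
Proof.
  intros Hk s. apply (cont3_comp k (fun s => s) (fun _ => x) (fun _ => y)); auto;
    [apply continuous_id | apply continuous_const | apply continuous_const].
Qed.

(** Joint continuity gives a radius for each [s]; compactness of the unit interval makes it uniform,
    so the integrands are uniformly close. *)
Lemma cont2_RInt_unit (k : R -> R -> R -> R) :
  cont3 k -> cont2 (fun x y => RInt (fun s => k s x y) 0 1).
Proof.
  intros Hk. apply cont2_eps. intros x y eps Heps.
  destruct (functional_choice (fun (s : R) (d : posreal) => forall s' x' y',
     Rabs (s' - s) < d -> Rabs (x' - x) < d -> Rabs (y' - y) < d ->
     Rabs (k s' x' y' - k s x y) < eps / 4)) as [del Hdel].
  { intros s. destruct (proj1 (cont3_eps k) Hk s x y (eps / 4) ltac:(lra)) as (d & Hd & H).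
    exists (mkposreal d Hd). exact H. }
  destruct (compactness_value_1d 0 1 del) as [d Hd].
  exists d. split; [apply cond_pos|]. intros x' y' Hx Hy.
  assert (Int : forall x y, ex_RInt (fun s => k s x y) 0 1).
  { intros x0 y0. apply @ex_RInt_continuous. intros; apply cont3_section_1, Hk. }
  rewrite <- (RInt_minus (V := R_CompleteNormedModule)) by auto.
  apply Rle_lt_trans with ((1 - 0) * (eps / 2)); [|lra].
  apply abs_RInt_le_const; [lra | apply @ex_RInt_minus; auto |].
  intros s Hs. change (Rabs (k s x' y' - k s x y) <= eps / 2).
  destruct (Rle_dec (Rabs (k s x' y' - k s x y)) (eps / 2)) as [|Hn]; auto.
  (* Compactness yields the centre [t] only under a double negation, hence the argument by
     contradiction. Both values at [s] are within [eps / 4] of [k t x y]. *)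
  exfalso. apply (Hd s Hs). intros (t & Ht & Hst & Hdt). apply Hn.
  pose proof (Hdel t s x' y' Hst ltac:(lra) ltac:(lra)) as H1.
  pose proof (Hdel t s x y Hst) as H2.
  rewrite !Rminus_diag, Rabs_R0 in H2.
  specialize (H2 (cond_pos _) (cond_pos _)).
  replace (k s x' y' - k s x y) with ((k s x' y' - k t x y) - (k s x y - k t x y)) by ring.
  eapply Rle_trans; [apply Rabs_triang|]. rewrite Rabs_Ropp. lra.
Qed.

Lemma cont3_triple (F a b c : R -> R -> R -> R) :
  cont3 F -> cont3 a -> cont3 b -> cont3 c ->
  cont3 (fun t x y => F (a t x y) (b t x y) (c t x y)).
Proof.
  intros HF Ha Hb Hc t x y.
  apply (cont3_comp F (fun z => a (fst (fst z)) (snd (fst z)) (snd z))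
           (fun z => b (fst (fst z)) (snd (fst z)) (snd z))
           (fun z => c (fst (fst z)) (snd (fst z)) (snd z))); auto.
Qed.

Lemma cont3_pair (f : R -> R -> R) (a b : R -> R -> R -> R) :
  cont2 f -> cont3 a -> cont3 b -> cont3 (fun t x y => f (a t x y) (b t x y)).
Proof.
  intros Hf Ha Hb t x y.
  apply (cont2_comp f (fun z => a (fst (fst z)) (snd (fst z)) (snd z))
           (fun z => b (fst (fst z)) (snd (fst z)) (snd z))); auto.
Qed.

Lemma cont3_proj :
  cont3 (fun t _ _ => t) /\ cont3 (fun _ x _ => x) /\ cont3 (fun _ _ y => y).
Proof.
  split; [|split]; intros t x y.
  - apply (continuous_comp fst fst); apply continuous_fst.
  - apply (continuous_comp fst snd); [apply continuous_fst | apply continuous_snd].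
  - apply continuous_snd.
Qed.

(** With sum and product seen as functions of two variables, [cont3_pair] also handles arithmetic
    expressions. *)
Lemma cont2_plus_fun : cont2 Rplus.
Proof.
  intros x y. apply (continuous_plus (V := R_NormedModule) fst snd);
    [apply continuous_fst | apply continuous_snd].
Qed.

Lemma cont2_mult_fun : cont2 Rmult.
Proof.
  intros x y. apply (continuous_mult (K := R_AbsRing) fst snd);
    [apply continuous_fst | apply continuous_snd].
Qed.

(** A linear substitution moves the variable bound into the integrand and leaves the unit interval;
    the [+ 0] matches the affine form of [RInt_comp_lin]. *)
Lemma cont2_RInt_upper (k : R -> R -> R -> R) (b : R -> R -> R) :
  cont3 k -> cont2 b -> cont2 (fun x y => RInt (fun s => k s x y) 0 (b x y)).
Proof.
  intros Hk Hb.
  replace (fun x y => RInt (fun s => k s x y) 0 (b x y))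
    with (fun x y => RInt (fun s => b x y * k (b x y * s + 0) x y) 0 1).
  - apply (cont2_RInt_unit (fun s x y => b x y * k (b x y * s + 0) x y)).
    destruct cont3_proj as (Pt & Px & Py).
    assert (Cb : cont3 (fun _ x y => b x y)) by (apply (cont3_pair b); auto).
    apply (cont3_pair Rmult); auto using cont2_mult_fun.
    apply (cont3_triple k); auto.
    apply (cont3_pair Rplus); auto using cont2_plus_fun.
    + apply (cont3_pair Rmult); auto using cont2_mult_fun.
    + intros t x y. apply continuous_const.
  - extensionality x; extensionality y.
    pose proof (RInt_comp_lin (fun s => k s x y) (b x y) 0 0 1) as E.
    simpl in E. unfold scal in E; simpl in E. unfold mult in E; simpl in E.
    rewrite E.
    + f_equal; ring.
    + apply @ex_RInt_continuous. intros; apply cont3_section_1, Hk.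
Qed.

(** The arguments are swapped: parameter first, integration variable second, as in the Leibniz
    rule. *)
Lemma cont3_section_12 (k : R -> R -> R -> R) (y : R) : cont3 k -> cont2 (fun x s => k s x y).
Proof.
  intros Hk x s. apply (cont3_comp k snd fst (fun _ => y)); auto.
  - apply continuous_snd.
  - apply continuous_fst.
  - apply continuous_const.
Qed.

Lemma cont3_section_13 (k : R -> R -> R -> R) (x : R) : cont3 k -> cont2 (fun y s => k s x y).
Proof.
  intros Hk y s. apply (cont3_comp k snd (fun _ => x) fst); auto.
  - apply continuous_snd.
  - apply continuous_const.
  - apply continuous_fst.
Qed.

Lemma C1_RInt_upper (k k1 k2 : R -> R -> R -> R) (b : R -> R -> R) :
  cont3 k -> cont3 k1 -> cont3 k2 -> Ck 1 b ->
  (forall s x y, is_derive (fun x => k s x y) x (k1 s x y)) ->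
  (forall s x y, is_derive (fun y => k s x y) y (k2 s x y)) ->
  Ck 1 (fun x y => RInt (fun s => k s x y) 0 (b x y)).
Proof.
  intros Hk H1 H2 Hb D1 D2. assert (cb := Ck_cont2 _ _ Hb).
  assert (Ckb : cont2 (fun x y => k (b x y) x y)).
  { intros x y. apply (cont3_comp k (fun z => b (fst z) (snd z)) fst snd); auto;
      [apply continuous_fst | apply continuous_snd]. }
  apply (C1_intro _
    (fun x y => RInt (fun s => k1 s x y) 0 (b x y) + k (b x y) x y * pd1 b x y)
    (fun x y => RInt (fun s => k2 s x y) 0 (b x y) + k (b x y) x y * pd2 b x y)).
  - intros x y.
    apply (is_derive_RInt_upper (fun x s => k s x y) (fun x s => k1 s x y) (fun x => b x y)).
    + apply cont3_section_12, Hk.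
    + apply cont3_section_12, H1.
    + intros; apply D1.
    + apply (pd1_is_derive 0), Hb.
  - intros x y.
    apply (is_derive_RInt_upper (fun y s => k s x y) (fun y s => k2 s x y) (fun y => b x y)).
    + apply cont3_section_13, Hk.
    + apply cont3_section_13, H2.
    + intros; apply D2.
    + apply (pd2_is_derive 0), Hb.
  - apply (Ck_plus 0); [apply (cont2_RInt_upper k1 b H1 cb)|].
    apply (Ck_mult 0 (fun x y => k (b x y) x y)); [exact Ckb | apply Hb].
  - apply (Ck_plus 0); [apply (cont2_RInt_upper k2 b H2 cb)|].
    apply (Ck_mult 0 (fun x y => k (b x y) x y)); [exact Ckb | apply Hb].
Qed.

(** * The transport equation *)

Lemma is_derive_recenter (f : R -> R) (x l : R) :
  is_derive (fun h => f (x + h)) 0 l -> is_derive f x l.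
Proof.
  intros H. apply (is_derive_ext (fun r => f (x + (- x + r)))).
  { intros r. f_equal. ring. }
  apply (is_derive_shift (fun h => f (x + h))). rewrite Rplus_opp_l. exact H.
Qed.

(** Along a trajectory [u] minus time has derivative zero, so the mean value bound with constant 0
    makes it constant. *)
Lemma flow_function_time (p q u : R -> R -> R) (X Y : R -> R -> R -> R) (t x y : R) :
  Ck 1 u -> is_flow p q X Y ->
  (forall x y, pd1 u x y * p x y + pd2 u x y * q x y = 1) ->
  u (X t x y) (Y t x y) = u x y + t.
Proof.
  intros Cu HF Hu. destruct (HF x y) as (E1 & E2 & S).
  pose proof (MVT_abs_bound (fun t => u (X t x y) (Y t x y) - t) (fun _ => 0) 0 t 0) as H.
  cbv beta in H. rewrite E1, E2, Rmult_0_l in H.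
  assert (Rabs (u (X t x y) (Y t x y) - t - (u x y - 0)) <= 0).
  { apply H.
    - intros r _. replace 0 with (pd1 u (X r x y) (Y r x y) * p (X r x y) (Y r x y) +
        pd2 u (X r x y) (Y r x y) * q (X r x y) (Y r x y) - 1) by (rewrite Hu; ring).
      apply (is_derive_minus (fun r => u (X r x y) (Y r x y)) (fun r : R => r)).
      + apply (C1_comp_curve u (fun r => X r x y) (fun r => Y r x y)); auto;
          [exact (proj1 (S r)) | exact (proj2 (S r))].
      + apply @is_derive_id.
    - intros r _. rewrite Rabs_R0. lra. }
  assert (u (X t x y) (Y t x y) - t - (u x y - 0) = 0); [|lra].
  apply Rabs_eq_0. pose proof (Rabs_pos (u (X t x y) (Y t x y) - t - (u x y - 0))). lra.
Qed.

(* Integrate g along each trajectory, starting from the level curve u = 0,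
   which the trajectory through (x, y) crosses at time - u(x, y). *)
Lemma transport_solution (p q u g : R -> R -> R) (M : R) :
  Ck 2 p -> Ck 2 q -> bounded_by M p -> bounded_by M q -> Ck 1 u -> Ck 1 g ->
  (forall x y, pd1 u x y * p x y + pd2 u x y * q x y = 1) ->
  exists w, Ck 1 w /\ forall x y, pd1 w x y * p x y + pd2 w x y * q x y = g x y.
Proof.
  intros Cp Cq Bp Bq Cu Cg Hu.
  assert (Cp1 := Ck_pred _ _ Cp). assert (Cq1 := Ck_pred _ _ Cq).
  destruct (flow_exists p q M Cp1 Cq1 Bp Bq) as (X & Y & HF).
  destruct (flow_cont3 p q M X Y Cp1 Cq1 Bp Bq HF) as [CX CY].
  destruct (flow_C1 p q M X Y 1 0 Cp Cq Bp Bq HF) as (X1 & Y1 & CX1 & CY1 & D1);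
    [rewrite Rabs_R1; lra | rewrite Rabs_R0; lra |].
  destruct (flow_C1 p q M X Y 0 1 Cp Cq Bp Bq HF) as (X2 & Y2 & CX2 & CY2 & D2);
    [rewrite Rabs_R0; lra | rewrite Rabs_R1; lra |].
  set (k := fun s x y => g (X s x y) (Y s x y)).
  set (dk := fun (X' Y' : R -> R -> R -> R) s x y =>
     pd1 g (X s x y) (Y s x y) * X' s x y + pd2 g (X s x y) (Y s x y) * Y' s x y).
  assert (Cdk : forall X' Y', cont3 X' -> cont3 Y' -> cont3 (dk X' Y')).
  { intros X' Y' CX' CY'. apply (cont3_pair Rplus); [apply cont2_plus_fun | |].
    - apply (cont3_pair Rmult); auto using cont2_mult_fun. apply (cont3_pair (pd1 g)); auto.
      apply Cg.
    - apply (cont3_pair Rmult); auto using cont2_mult_fun. apply (cont3_pair (pd2 g)); auto.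
      apply Cg. }
  assert (Ckk : cont3 k) by (apply (cont3_pair g); auto; apply (Ck_cont2 1), Cg).
  set (W := fun x y => RInt (fun s => k s x y) 0 (- u x y)).
  assert (CW : Ck 1 W).
  { apply (C1_RInt_upper k (dk X1 Y1) (dk X2 Y2) (fun x y => - u x y)); auto.
    - apply Ck_opp, Cu.
    - intros s x y. apply (C1_comp_curve g (fun x => X s x y) (fun x => Y s x y)); auto.
      + apply is_derive_recenter. destruct (D1 s x y) as [D _].
        refine (is_derive_ext _ _ _ _ _ D). intros h. f_equal; ring.
      + apply is_derive_recenter. destruct (D1 s x y) as [_ D].
        refine (is_derive_ext _ _ _ _ _ D). intros h. f_equal; ring.
    - intros s x y. apply (C1_comp_curve g (fun y => X s x y) (fun y => Y s x y)); auto.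
      + apply is_derive_recenter. destruct (D2 s x y) as [D _].
        refine (is_derive_ext _ _ _ _ _ D). intros h. f_equal; ring.
      + apply is_derive_recenter. destruct (D2 s x y) as [_ D].
        refine (is_derive_ext _ _ _ _ _ D). intros h. f_equal; ring. }
  (* [W] integrates from the point to the level curve; the sign reverses the direction. *)
  set (w := fun x y => - W x y).
  assert (Cw : Ck 1 w) by (apply Ck_opp, CW).
  exists w. split; auto. intros x y.
  destruct (HF x y) as (E1 & E2 & S).
  (* The derivative of [w] along the trajectory at time 0 is computed twice, here by the chain rule
     and in [Dg] from the integral; comparison gives the equation. *)
  assert (Dw : is_derive (fun t => w (X t x y) (Y t x y)) 0
                 (pd1 w x y * p x y + pd2 w x y * q x y)).
  { pose proof (C1_comp_curve w (fun t => X t x y) (fun t => Y t x y) 0 _ _ Cw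
      (proj1 (S 0)) (proj2 (S 0))) as H. simpl in H. rewrite E1, E2 in H. exact H. }
  (* By the group law, the integrand seen from the point at time [t] is the original one shifted by
     [t], and the end [- (u x y + t)] shifts back to [- u x y]. Only the other end of the integral
     moves with [t]. *)
  assert (Along : forall t, w (X t x y) (Y t x y) =
                    - RInt (fun s => k s x y) 0 (- u x y) + RInt (fun s => k s x y) 0 t).
  { intros t. unfold w, W.
    rewrite (flow_function_time p q u X Y t x y Cu HF Hu).
    assert (Int : forall a b, ex_RInt (fun s => k s x y) a b).
    { intros a b. apply @ex_RInt_continuous. intros; apply cont3_section_1, Ckk. }
    rewrite (RInt_ext _ (fun s => 1 * k (1 * s + t) x y)).
    2:{ intros s _. unfold k. destruct (flow_add p q M X Y t s x y Cp1 Cq1 Bp Bq HF) as [F1 F2].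
        rewrite <- F1, <- F2, !Rmult_1_l, (Rplus_comm s t). reflexivity. }
    pose proof (RInt_comp_lin (fun s => k s x y) 1 t 0 (- (u x y + t)) (Int _ _)) as E.
    unfold scal in E; simpl in E. unfold mult in E; simpl in E. rewrite E.
    pose proof (RInt_Chasles (fun s => k s x y) 0 t (- u x y) (Int _ _) (Int _ _)) as Ch.
    unfold plus in Ch; simpl in Ch. rewrite <- Ch.
    replace (1 * 0 + t) with t by ring.
    replace (1 * - (u x y + t) + t) with (- u x y) by ring. ring. }
  assert (Dg : is_derive (fun t => w (X t x y) (Y t x y)) 0 (g x y)).
  { apply (is_derive_ext
      (fun t => - RInt (fun s => k s x y) 0 (- u x y) + RInt (fun s => k s x y) 0 t)).
    - intros t. symmetry. apply Along.
    - replace (g x y) with (k 0 x y) by (unfold k; rewrite E1, E2; reflexivity).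
      apply (is_derive_primitive (fun s => k s x y)). apply cont3_section_1, Ckk. }
  rewrite <- (is_derive_unique _ _ _ Dw). apply is_derive_unique, Dg.
Qed.

(** The length of [grad u / |grad u|^2] is [1 / |grad u|], so a lower bound on the gradient becomes
    an upper bound on the field. *)
Lemma div_grad_sq_bound (a b c : R) :
  0 < c -> c <= sqrt (a ^ 2 + b ^ 2) -> Rabs (a * / (a ^ 2 + b ^ 2)) <= / c.
Proof.
  intros Hc Hs. set (s := sqrt (a ^ 2 + b ^ 2)) in *.
  pose proof (pow2_ge_0 a). pose proof (pow2_ge_0 b).
  assert (E : a ^ 2 + b ^ 2 = s * s) by (unfold s; rewrite sqrt_sqrt; lra).
  rewrite E, Rabs_mult, (Rabs_pos_eq (/ (s * s))) by (left; apply Rinv_0_lt_compat; nra).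
  assert (Ha : Rabs a <= s).
  { apply Rsqr_incr_0; [|apply Rabs_pos | lra]. rewrite <- Rsqr_abs. unfold Rsqr. nra. }
  apply Rle_trans with (s * / (s * s)).
  - apply Rmult_le_compat_r; auto. left; apply Rinv_0_lt_compat; nra.
  - replace (s * / (s * s)) with (/ s) by (field; lra). apply Rinv_le_contravar; lra.
Qed.

(* Phi = (P1, P2); Jacobian rows are gradients of P1 and P2.
   inf |grad u| > 0 is expressed as a positive uniform lower bound c. *)
Theorem theoremA1 (u : R -> R -> R) :
  Ck 3 u ->
  (exists c : R, 0 < c /\ forall x y : R, c <= grad_norm u x y) ->
  exists P1 P2 : R -> R -> R,
    Ck 1 P1 /\ Ck 1 P2 /\
    (forall x y : R,
        pd1 P1 x y * pd2 P2 x y - pd2 P1 x y * pd1 P2 x y <> 0) /\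
    (forall x y : R,
        pd1 P1 x y * pd1 u x y + pd2 P1 x y * pd2 u x y = 1 /\
        pd1 P2 x y * pd1 u x y + pd2 P2 x y * pd2 u x y = 0).
Proof.
  intros Cu (c & Hc & Hgrad). unfold grad_norm in Hgrad.
  assert (Cu1 : Ck 1 u) by (apply Ck_pred, Ck_pred, Cu).
  assert (Cux : Ck 2 (pd1 u)) by apply Cu.
  assert (Cuy : Ck 2 (pd2 u)) by apply Cu.
  set (N := fun x y => pd1 u x y ^ 2 + pd2 u x y ^ 2).
  (* [sqrt] is 0 on nonpositive reals, so its positive lower bound forces [N] to be positive. *)
  assert (HN : forall x y, 0 < N x y).
  { intros x y. specialize (Hgrad x y). fold (N x y) in Hgrad.
    destruct (Rlt_dec 0 (N x y)) as [|Hn]; auto.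
    rewrite sqrt_neg_0 in Hgrad; lra. }
  assert (CN : Ck 2 N).
  { apply (Ck_plus 2 (fun x y => pd1 u x y ^ 2)).
    - apply (Ck_mult 2 (pd1 u) (fun x y => pd1 u x y * 1)); auto.
      apply (Ck_mult 2 (pd1 u)); auto using Ck_const.
    - apply (Ck_mult 2 (pd2 u) (fun x y => pd2 u x y * 1)); auto.
      apply (Ck_mult 2 (pd2 u)); auto using Ck_const. }
  assert (CI : Ck 2 (fun x y => / N x y)).
  { apply Ck_inv; auto. intros x y. specialize (HN x y). lra. }
  set (p := fun x y => pd1 u x y * / N x y).
  set (q := fun x y => pd2 u x y * / N x y).
  assert (Cp : Ck 2 p) by (apply Ck_mult; auto).
  assert (Cq : Ck 2 q) by (apply Ck_mult; auto).
  assert (Bp : bounded_by (/ c) p).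
  { intros x y. apply div_grad_sq_bound; auto. }
  assert (Bq : bounded_by (/ c) q).
  { intros x y. unfold q, N. rewrite Rplus_comm. apply div_grad_sq_bound; auto.
    rewrite Rplus_comm. auto. }
  assert (Hu : forall x y, pd1 u x y * p x y + pd2 u x y * q x y = 1).
  { intros x y. specialize (HN x y). unfold p, q. unfold N in *. field. lra. }
  (* The field is [grad u / N], so the right-hand side [f / N] compensates the weight. *)
  assert (Transport : forall f, Ck 1 f -> exists w, Ck 1 w /\
            forall x y, pd1 w x y * pd1 u x y + pd2 w x y * pd2 u x y = f x y).
  { intros f Cf.
    destruct (transport_solution p q u (fun x y => f x y * / N x y) (/ c)) as (w & Cw & Hw);
      auto.
    - apply Ck_mult; auto. apply Ck_pred, CI.
    - exists w. split; auto. intros x y. specialize (Hw x y). specialize (HN x y).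
      unfold p, q in Hw.
      apply (Rmult_eq_reg_r (/ N x y)); [|apply Rinv_neq_0_compat; lra].
      rewrite <- Hw. ring. }
  destruct (Transport (fun _ _ => 1) (Ck_const 1 1)) as (P1 & CP1 & HP1).
  destruct (Transport (fun x y => - (pd1 (pd1 u) x y + pd2 (pd2 u) x y))) as (w & Cw & Hw).
  (* Third derivatives of [u] enter here: the Laplacian is of class C^1. *)
  { apply Ck_opp, Ck_plus; [apply Cux | apply Cuy]. }
  set (la := fun x y => exp (w x y)).
  assert (Cla : Ck 1 la) by (apply Ck_exp; auto).
  assert (Cux1 := Ck_pred _ _ Cux). assert (Cuy1 := Ck_pred _ _ Cuy).
  destruct (poincare_potential (fun x y => - (la x y * pd2 u x y))
              (fun x y => la x y * pd1 u x y)) as (P2 & CP2 & HP2).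
  - apply Ck_opp, Ck_mult; auto.
  - apply Ck_mult; auto.
  - intros x y.
    assert (D2 : is_derive (fun t => - (la x t * pd2 u x t)) y
       (- (exp (w x y) * pd2 w x y * pd2 u x y + la x y * pd2 (pd2 u) x y))).
    { apply (is_derive_opp (fun t => la x t * pd2 u x t)).
      apply (is_derive_mult (fun t => la x t) (fun t => pd2 u x t)).
      - apply (is_derive_exp_comp (fun t => w x t)), (pd2_is_derive 0), Cw.
      - apply (pd2_is_derive 0), Cuy1.
      - intros; apply Rmult_comm. }
    assert (D1 : is_derive (fun t => la t y * pd1 u t y) x
       (exp (w x y) * pd1 w x y * pd1 u x y + la x y * pd1 (pd1 u) x y)).
    { apply (is_derive_mult (fun t => la t y) (fun t => pd1 u t y)).
      - apply (is_derive_exp_comp (fun t => w t y)), (pd1_is_derive 0), Cw.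
      - apply (pd1_is_derive 0), Cux1.
      - intros; apply Rmult_comm. }
    refine (eq_trans (is_derive_unique _ _ _ D2)
              (eq_trans _ (eq_sym (is_derive_unique _ _ _ D1)))).
    specialize (Hw x y). unfold la. pose proof (exp_pos (w x y)).
    apply Rminus_diag_uniq.
    (* The defect of closedness is minus the divergence of [exp w * grad u], which the equation for
       [w] cancels. *)
    replace (- (exp (w x y) * pd2 w x y * pd2 u x y + exp (w x y) * pd2 (pd2 u) x y) -
             (exp (w x y) * pd1 w x y * pd1 u x y + exp (w x y) * pd1 (pd1 u) x y))
      with (- exp (w x y) * (pd1 w x y * pd1 u x y + pd2 w x y * pd2 u x y
                             + (pd1 (pd1 u) x y + pd2 (pd2 u) x y))) by ring.
    rewrite Hw. ring.
  - exists P1, P2. split; [exact CP1|]. split; [exact CP2|]. split; intros x y;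
      destruct (HP2 x y) as [-> ->]; specialize (HP1 x y).
    + replace (pd1 P1 x y * (la x y * pd1 u x y) - pd2 P1 x y * - (la x y * pd2 u x y))
        with (la x y * (pd1 P1 x y * pd1 u x y + pd2 P1 x y * pd2 u x y)) by ring.
      rewrite HP1, Rmult_1_r. apply Rgt_not_eq, exp_pos.
    + split; [exact HP1 | ring].
Qed.
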